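(* Let $Q:\mathbb{R}^{d_1}\times\mathbb{R}^k\times\mathbb{R}^d\to\mathbb{R}$ be a trilinear form, and let $\mathcal{Q}$ and $\mathcal{N}_{\mathcal R}(Q)$ be defined from $Q$ as in the context. For $s\ge0$ let $$o_s := \Big(\underbrace{\tfrac{s}{d_1},\ldots,\tfrac{s}{d_1}}_{d_1\text{ copies}},\underbrace{\tfrac{s}{k},\ldots,\tfrac{s}{k}}_{k\text{ copies}},\underbrace{\tfrac{s}{d},\ldots,\tfrac{s}{d}}_{d\text{ copies}}\Big).$$ The following are true: \begin{enumerate} \item For any $s\geq0$, the point $o_s$ belongs to $\mathcal N_{\mathcal R}(Q)$ if and only if there exists $c>0$ such that every trilinear form $Q'$ sufficiently close to $Q$ in the standard topology generates a functional $\mathcal{Q}'$ (defined from $Q'$ in the same way $\mathcal Q$ is defined from $Q$) satisfying $$\mathcal{Q}'[\{u_i\}_{i=1}^{d_1},\{v_i\}_{i=1}^k,\{w_i\}_{i=1}^d] \geq c\,|\det\{u_i\}_{i=1}^{d_1}|^{\frac{s}{d_1}}\,|\det\{v_i\}_{i=1}^k|^{\frac sk}\,|\det\{w_i\}_{i=1}^d|^{\frac sd}$$ for any bases $\{u_i\}_{i=1}^{d_1}$, $\{v_i\}_{i=1}^k$, $\{w_i\}_{i=1}^d$ of $\mathbb{R}^{d_1},\mathbb{R}^k,\mathbb{R}^d$, respectively. \item For any $s\ge0$, the point $o_s$ fails to belong to $\mathcal N_{\mathcal R}(Q)$ if and only if there exist orthonormal bases $\{u_i\}_{i=1}^{d_1}$,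 $\{v_i\}_{i=1}^k$, $\{w_i\}_{i=1}^d$ diagonalizing certain symmetric matrices $D_1,D_2,D_3$, respectively, such that the trace of $D_1$ is positive, the traces of $D_2$ and $D_3$ are zero, and $$\frac{\mathcal{Q}[\{e^{\tau D_1}u_i\}_{i=1}^{d_1},\{e^{\tau D_2}v_i\}_{i=1}^k,\{e^{\tau D_3}w_i\}_{i=1}^d]}{|\det\{e^{\tau D_1}u_i\}_{i=1}^{d_1}|^{\frac s{d_1}}|\det\{e^{\tau D_2}v_i\}_{i=1}^k|^{\frac sk}|\det\{e^{\tau D_3}w_i\}_{i=1}^d|^{\frac sd}}\to0$$ as $\tau\to\infty$. (Note that $|\det\{e^{\tau D_1}u_i\}|\to\infty$ as $\tau\to\infty$ and $|\det\{e^{\tau D_2}v_i\}|=|\det\{v_i\}|=1=|\det\{e^{\tau D_3}w_i\}|=|\det\{w_i\}|$ for all $\tau$.) \end{enumerate}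
   Context: $d_1,k,d$ are positive integers. For a basis, $\det\{u_i\}$ denotes the determinant of the matrix with columns $u_i$. For $s\ge1$ let $Q_s(t,v_1,\dots,v_s,w_1,\dots,w_s):=\det[Q(t,v_a,w_b)]_{a,b=1}^s$ for $t\in\mathbb{R}^{d_1}$, $v_a\in\mathbb{R}^k$, $w_b\in\mathbb{R}^d$. For bases $\{u_i\}_{i=1}^{d_1}$, $\{v_i\}_{i=1}^k$, $\{w_i\}_{i=1}^d$, the nonnegative quantity $\mathcal{Q}$ is defined by $$\big(\mathcal{Q}[\{u_i\},\{v_i\},\{w_i\}]\big)^2:=1+\sum_{s=1}^{\min\{d,k\}}\ \sum_{i_1,\dots,i_s=1}^{d_1}\ \sum_{i_1',\dots,i_s'=1}^{k}\ \sum_{i_1'',\dots,i_s''=1}^{d}\Big|(u_{i_1}\cdot\nabla_t)\cdots(u_{i_s}\cdot\nabla_t)Q_s(t,v_{i_1'},\dots,v_{i_s'},w_{i_1''},\dots,w_{i_s''})\Big|^2$$ (independent of $t$, since $Q_s$ is homogeneous of degree $s$ in $t$). A multiindex $\beta\in\mathbb{Z}_{\ge0}^m$ counts a finite sequence in $\{1,\dots,m\}$ when exactly $\beta_\ell$ of its terms equal $\ell$, for each $\ell$. Given orthonormal bases $\{\tilde u_i\}_{i=1}^{d_1},\{\tilde v_i\}_{i=1}^k,\{\tilde w_i\}_{i=1}^d$ and multiindices $\alpha\in\mathbb{Z}_{\ge0}^{d_1},\beta\in\mathbb{Z}_{\ge0}^k,\gamma\in\mathbb{Z}_{\ge0}^d$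 with $|\alpha|=|\beta|=|\gamma|=s\ge1$, let $(\tilde u\cdot\nabla_t)^\alpha Q_s(t,\tilde v_\beta,\tilde w_\gamma)$ denote $(\tilde u_{i_1}\cdot\nabla_t)\cdots(\tilde u_{i_s}\cdot\nabla_t)Q_s(t,\tilde v_{i'_1},\dots,\tilde v_{i'_s},\tilde w_{i''_1},\dots,\tilde w_{i''_s})$ for some index sequences counted by $\alpha,\beta,\gamma$, respectively (well defined up to sign). Let $N_0(Q,\{\tilde u_i\},\{\tilde v_i\},\{\tilde w_i\})$ be the set of all $(\alpha,\beta,\gamma)$ with $|\alpha|=|\beta|=|\gamma|\le\min\{d,k\}$ such that either $|\alpha|=0$ or $(\tilde u\cdot\nabla_t)^\alpha Q_{|\alpha|}(t,\tilde v_\beta,\tilde w_\gamma)\ne0$. Then $\mathcal N_{\mathcal R}(Q)$ is the intersection, over all triples of orthonormal bases of $\mathbb{R}^{d_1},\mathbb{R}^k,\mathbb{R}^d$, of the convex hulls in $[0,\infty)^{d_1+k+d}$ of the sets $N_0(Q,\{\tilde u_i\},\{\tilde v_i\},\{\tilde w_i\})$. *)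

(* Defs.v *)
From HB Require Import structures.
From mathcomp Require Import all_boot all_order all_algebra.
From mathcomp Require Import all_classical all_reals all_analysis.

Set Implicit Arguments.
Unset Strict Implicit.
Unset Printing Implicit Defensive.

Import Order.TTheory GRing.Theory Num.Theory.
Import numFieldNormedType.Exports.
Local Open Scope classical_set_scope.
Local Open Scope ring_scope.

Section Bases.
Variables (R : realType) (n : nat).
Implicit Types (u : 'I_n -> 'cV[R]_n) (D : 'M[R]_n).

Definition is_basis u : Prop :=
  basis_of fullv [seq u i | i <- enum 'I_n].

Definition orthonormal_basis u : Prop :=
  is_basis u /\
  forall i j, \sum_(l < n) u i l 0 * u j l 0 = (i == j)%:R.

Definition basis_det u : R := \det (\matrix_(l, i) u i l 0).

Definition symmetric_mx D : Prop := D^T = D.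

Definition diagonalizes u D : Prop :=
  forall i, exists lambda : R, D *m u i = lambda *: u i.

Definition expmx D : 'M[R]_n :=
  limn (series (fun m : nat => (m`!%:R)^-1 *: D ^+ m)).

End Bases.

Section TrilinearForms.
Variables (R : realType) (d1 k d : nat).

Definition triform := 'cV[R]_d1 -> 'cV[R]_k -> 'cV[R]_d -> R.

Definition trilinear (Q : triform) : Prop :=
  [/\ forall v w, scalar (fun t => Q t v w),
      forall t w, scalar (fun v => Q t v w) &
      forall t v, scalar (fun w => Q t v w)].

(* The trilinear forms are a finite-dimensional real vector space with
   coordinates Q e_i e_j e_l, so their standard topology is the one of the
   sup norm of these coordinates. *)
Definition near_form (Q : triform) (P : triform -> Prop) : Prop :=
  exists2 e : R, 0 < e &
    forall Q' : triform, trilinear Q' ->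
      (forall i j l,
         `|Q' (delta_mx i 0) (delta_mx j 0) (delta_mx l 0) -
           Q (delta_mx i 0) (delta_mx j 0) (delta_mx l 0)| < e) ->
      P Q'.

Definition Qdet (Q : triform) (s : nat) (t : 'cV[R]_d1)
    (v : 'I_s -> 'cV[R]_k) (w : 'I_s -> 'cV[R]_d) : R :=
  \det (\matrix_(a < s, b < s) Q t (v a) (w b)).

Definition iter_derive (s : nat) (u : 'I_s -> 'cV[R]_d1)
    (f : 'cV[R]_d1 -> R) : 'cV[R]_d1 -> R :=
  foldr (fun x g => 'D_x g) f [seq u a | a <- enum 'I_s].

(* Qdet Q is homogeneous of degree s in t, so its s-fold derivatives are
   constant in t; they are evaluated at t = 0. *)
Definition derive_Qdet (Q : triform) (s : nat) (u : 'I_s -> 'cV[R]_d1)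
    (v : 'I_s -> 'cV[R]_k) (w : 'I_s -> 'cV[R]_d) : R :=
  iter_derive u (fun t => Qdet Q t v w) 0.

Definition calQ (Q : triform) (u : 'I_d1 -> 'cV[R]_d1) (v : 'I_k -> 'cV[R]_k)
    (w : 'I_d -> 'cV[R]_d) : R :=
  Num.sqrt (1 + \sum_(1 <= s < (minn d k).+1)
    \sum_(i : {ffun 'I_s -> 'I_d1})
    \sum_(i' : {ffun 'I_s -> 'I_k})
    \sum_(i'' : {ffun 'I_s -> 'I_d})
      `|derive_Qdet Q (u \o i) (v \o i') (w \o i'')| ^+ 2).

Definition counts (m s : nat) (b : 'I_m -> nat) (i : 'I_s -> 'I_m) : Prop :=
  forall l, #|[pred a | i a == l]| = b l.

Definition triple_point (x : 'rV[R]_d1) (y : 'rV[R]_k) (z : 'rV[R]_d) :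
  'rV[R]_(d1 + k + d) := row_mx (row_mx x y) z.

Definition multiindex_point (al : 'I_d1 -> nat) (be : 'I_k -> nat)
    (ga : 'I_d -> nat) : 'rV[R]_(d1 + k + d) :=
  triple_point (\row_l (al l)%:R) (\row_l (be l)%:R) (\row_l (ga l)%:R).

(* Another choice of the sequences i, i', i'' changes derive_Qdet at most by
   its sign. *)
Definition N0 (Q : triform) (u : 'I_d1 -> 'cV[R]_d1) (v : 'I_k -> 'cV[R]_k)
    (w : 'I_d -> 'cV[R]_d) : set 'rV[R]_(d1 + k + d) :=
  [set x | exists (s : nat) (al : 'I_d1 -> nat) (be : 'I_k -> nat)
                  (ga : 'I_d -> nat),
    [/\ (\sum_l al l = s)%N, (\sum_l be l = s)%N & (\sum_l ga l = s)%N] /\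
    [/\ (s <= minn d k)%N,
        x = multiindex_point al be ga &
        s = 0%N \/
        exists (i : 'I_s -> 'I_d1) (i' : 'I_s -> 'I_k) (i'' : 'I_s -> 'I_d),
          [/\ counts al i, counts be i', counts ga i'' &
              derive_Qdet Q (u \o i) (v \o i') (w \o i'') <> 0]]].

Definition convex_hull (m : nat) (A : set 'rV[R]_m) : set 'rV[R]_m :=
  smallest (@convex_set R 'rV[R]_m) A.

Definition NR (Q : triform) : set 'rV[R]_(d1 + k + d) :=
  [set x | forall u v w,
    orthonormal_basis u -> orthonormal_basis v -> orthonormal_basis w ->
    convex_hull (N0 Q u v w) x].

Definition o_pt (s : R) : 'rV[R]_(d1 + k + d) :=
  triple_point (const_mx (s / d1%:R)) (const_mx (s / k%:R))
    (const_mx (s / d%:R)).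

Definition det_weight (s : R) (u : 'I_d1 -> 'cV[R]_d1)
    (v : 'I_k -> 'cV[R]_k) (w : 'I_d -> 'cV[R]_d) : R :=
  `|basis_det u| `^ (s / d1%:R) * `|basis_det v| `^ (s / k%:R) *
  `|basis_det w| `^ (s / d%:R).

End TrilinearForms.

(* Main.v *)
Require Import Defs.
From HB Require Import structures.
From mathcomp Require Import all_boot all_order all_algebra.
From mathcomp Require Import fingroup perm.
From mathcomp Require Import ring lra.
From mathcomp Require Import all_classical all_reals all_analysis.

Set Implicit Arguments.
Unset Strict Implicit.
Unset Printing Implicit Defensive.

Import Order.TTheory GRing.Theory Num.Theory.
Import numFieldNormedType.Exports.
Local Open Scope classical_set_scope.
Local Open Scope ring_scope.

(* Writing T(u, v, w) for the s-fold derivative of Q_s, which is the explicit signed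
   sum [form_det] of products Q(u_a, v_(r a), w_(p a)), the functional calQ^2 is 1
   plus a sum of squares that is invariant under orthogonal recombinations of each
   basis. By the singular value decomposition one may therefore take
   u_i = e^(a_i) u~_i with u~ orthonormal, and likewise for v and w; then every
   coefficient is multiplied by e^<(a,b,g),p> with p in N_0, and the determinantal
   weight is e^<(a,b,g),o_s>.

   If o_s is in the hull of N_0 for the orthonormal bases at hand, a half-space
   containing N_0 contains o_s, which gives the lower bound with a constant depending
   only on lower bounds for the nonzero T; these persist for nearby forms and bases,
   and the compactness of the orthogonal groups makes the constant uniform. If o_s is
   outside some hull, a separating functional (a, b, g), shifted so that b and g have
   zero sum, gives D_1, D_2, D_3. *)

(** * Iterated derivatives of products of linear forms *)

Section DerivativeOfProducts.
Variables (R : realType) (V : normedModType R) (I : finType).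
Implicit Types (l : I -> V -> R) (A : {set I}).

(** By linearity the difference quotient equals [f x] exactly for every nonzero increment, so it is
    eventually constant. *)
Lemma is_derive_scalar (f : V -> R) (t x : V) :
  scalar f -> is_derive t x f (f x).
Proof.
move=> lf.
have fE (h : R) : f (h *: x + t) - f t = h * f x by rewrite lf addrK.
have lim_f : h^-1 *: ((f \o shift t) (h *: x) - f t) @[h --> 0^'] --> f x.
  apply: cvg_near_cst; near=> h.
  rewrite /= fE scalerA mulVf ?scale1r//; near: h; exact: nbhs_dnbhs_neq.
apply: DeriveDef; first by apply/cvg_ex; exists (f x).
exact: cvg_lim lim_f.
Unshelve. all: by end_near. Qed.

Lemma is_derive_prod_scalar l A (t x : V) : (forall a, scalar (l a)) ->
  is_derive t x (fun y => \prod_(a in A) l a y)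
    (\sum_(b in A) l b x * \prod_(a in A :\ b) l a t).
Proof.
move=> ll; have [m] := ubnP #|A|; elim: m A => // m IH A /ltnSE leAm.
have [->|[b bA]] := set_0Vmem A.
  rewrite big_set0 (_ : (fun _ => _) = cst 1); first exact: is_derive_cst.
  by apply/funext => y; rewrite big_set0.
have {}IH := IH (A :\ b) (leq_trans (proper_card (properD1 bA)) leAm).
rewrite (_ : (fun _ => _) = l b * (fun y => \prod_(a in A :\ b) l a y));
  last by apply/funext => y; rewrite (big_setD1 b).
have dM := is_deriveM (is_derive_scalar t x (ll b)) IH.
apply: (is_derive_eq dM) => {dM}.
rewrite (big_setD1 b bA) /= addrC; congr (_ + _); last by rewrite [LHS]mulrC.
rewrite scaler_sumr; apply: eq_bigr => c /setD1P[cb cA].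
rewrite (big_setD1 b (A := A :\ c)) /=; last by rewrite !inE eq_sym cb.
have -> : (A :\ c) :\ b = (A :\ b) :\ c.
  by apply/finset.setP => y; rewrite !inE andbCA.
by rewrite [LHS]mulrCA.
Qed.

(** Linear combinations of products of linear forms are stable under differentiation: the new index
    is a pair of an old term and the factor that is differentiated. The coefficient 0 for a factor
    outside [A j] keeps the index type a plain product, so that the step can be iterated. *)
Lemma derive_comb_prod (J : finType) (c : J -> R) (l : J -> I -> V -> R)
    (A : J -> {set I}) (x : V) : (forall j a, scalar (l j a)) ->
  'D_x (fun t => \sum_j c j * \prod_(a in A j) l j a t) =
  (fun t => \sum_(p : J * I) (if p.2 \in A p.1 then c p.1 * l p.1 p.2 x else 0)
              * \prod_(a in A p.1 :\ p.2) l p.1 a t).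
Proof.
move=> ll; apply/funext => t.
have d j : is_derive t x (fun y => c j * \prod_(a in A j) l j a y)
    (c j * \sum_(b in A j) l j b x * \prod_(a in A j :\ b) l j a t).
  rewrite (_ : (fun _ => _) = c j \*: (fun y => \prod_(a in A j) l j a y)) //.
  exact: is_deriveZ (is_derive_prod_scalar (A j) t x (ll j)).
rewrite -(pair_bigA _ (fun j b => (if b \in A j then c j * l j b x else 0)
              * \prod_(a in A j :\ b) l j a t)) /=.
rewrite (_ : \sum_j _ = \sum_j
  (c j * \sum_(b in A j) l j b x * \prod_(a in A j :\ b) l j a t)); last first.
  apply: eq_bigr => j _; rewrite mulr_sumr [RHS]big_mkcond /=.
  by apply: eq_bigr => b _; case: ifP => _; rewrite ?mul0r// mulrA.
rewrite (reindex (@enum_val J xpredT)) /=; last first.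
  exact: (onW_bij _ (@enum_val_bij J)).
have -> : (fun y => \sum_j c j * \prod_(a in A j) l j a y) =
  \sum_(i < #|J|) (fun y => c (enum_val i)
    * \prod_(a in A (enum_val i)) l (enum_val i) a y).
  apply/funext => y; rewrite fct_sumE (reindex (@enum_val J xpredT)) //=.
  exact: (onW_bij _ (@enum_val_bij J)).
exact: (@derive_val _ _ _ _ _ _ _ (is_derive_sum (fun i => d (enum_val i)))).
Qed.

(** Each direction in turn consumes one factor of the product; the factors left at the end are
    evaluated at [t]. *)
Fixpoint perm_expand l A (us : seq V) (t : V) : R :=
  if us is x :: us' then \sum_(b in A) l b x * perm_expand l (A :\ b) us' t
  else \prod_(a in A) l a t.

(** [foldr] applies the last direction of its list first, hence the [rev]: the head of [us] is then
    differentiated first. The induction generalizes [J], because every derivative replaces it by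
    [J * I]. *)
Lemma foldr_derive_comb (us : seq V) (J : finType) (c : J -> R)
    (l : J -> I -> V -> R) (A : J -> {set I}) (t : V) :
  (forall j a, scalar (l j a)) ->
  foldr (fun x g => 'D_x g) (fun y => \sum_j c j * \prod_(a in A j) l j a y)
    (rev us) t =
  \sum_j c j * perm_expand (l j) (A j) us t.
Proof.
elim: us J c l A => [|x us IH] J c l A ll /=; first by [].
rewrite rev_cons foldr_rcons derive_comb_prod // IH //.
rewrite -(pair_bigA _ (fun j b => (if b \in A j then c j * l j b x else 0)
              * perm_expand (l j) (A j :\ b) us t)) /=.
apply: eq_bigr => j _; rewrite mulr_sumr [RHS]big_mkcond /=.
by apply: eq_bigr => b _; case: ifP => _; rewrite ?mul0r// mulrA.
Qed.

(** The tuple [tau] records which factor each direction consumed; no factor is consumed twice, so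
    [tau] has no repetition. *)
Lemma perm_expandE l A (us : seq V) (t : V) :
  perm_expand l A us t =
  \sum_(tau : (size us).-tuple I | uniq tau && all (mem A) tau)
    (\prod_(p <- zip tau us) l p.1 p.2) *
    \prod_(a in A | a \notin (tau : seq I)) l a t.
Proof.
elim: us A => [|x us IH] A /=.
  rewrite (big_pred1 [tuple]); last by move=> tau; rewrite [tau]tuple0.
  rewrite big_nil mul1r; apply: eq_bigl => a; by rewrite in_nil andbT.
under eq_bigr do rewrite IH mulr_sumr.
rewrite (reindex (fun p : I * (size us).-tuple I => cons_tuple p.1 p.2)) /=;
  last first.
  exists (fun tau : (size us).+1.-tuple I => (thead tau, behead_tuple tau)) =>
    [[b tau] _|tau _] /=;
    last by case/tupleP: tau => b tau; apply: val_inj.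
  by congr (_, _); apply: val_inj.
rewrite pair_big_dep /=; apply: eq_big => [[b tau]|[b tau] _] /=.
  rewrite -!andbA; case: (b \in A) => //=; last by rewrite !andbF.
  have -> : all (mem (A :\ b)) tau = (b \notin tau) && all (mem A) tau.
    apply/allP/andP => [H|[bt /allP H] y yt].
      split; first by apply/negP => /H; rewrite !inE eqxx.
      by apply/allP => y /H; rewrite !inE => /andP[].
    rewrite /= !inE; apply/andP; split; last exact: H y yt.
    by apply: contraNneq bt => <-.
  by case: (uniq tau); rewrite ?andbT ?andbF.
rewrite big_cons mulrA; congr (_ * _); apply: eq_bigl => a.
by rewrite !inE negb_or andbA [(a != b) && _]andbC.
Qed.

End DerivativeOfProducts.

(** With as many directions as factors every factor is consumed: the repetition-free tuples are the
    permutations and nothing depends on [t] any more. *)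
Lemma iter_derive_prod_scalar (R : realType) n s (u : 'I_s -> 'cV[R]_n)
    (J : finType) (c : J -> R) (l : J -> 'I_s -> 'cV[R]_n -> R) t :
  (forall j a, scalar (l j a)) ->
  iter_derive u (fun y => \sum_j c j * \prod_a l j a y) t =
  \sum_j c j * \sum_(r : 'S_s) \prod_a l j (r a) (u a).
Proof.
move=> ll; rewrite /iter_derive -[X in foldr _ _ X]revK.
rewrite (_ : (fun y => _) =
    fun y => \sum_j c j * \prod_(a in [set: 'I_s]%SET) l j a y); last first.
  apply/funext => y; apply: eq_bigr => j _; congr (_ * _).
  by apply: eq_bigl => a; rewrite inE.
rewrite (@foldr_derive_comb _ _ _ _ J c l (fun=> [set: 'I_s]%SET)) //.
apply: eq_bigr => j _; congr (_ * _); rewrite perm_expandE.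
have szu : size (rev [seq u a | a <- enum 'I_s]) = s.
  by rewrite size_rev size_map size_enum_ord.
have szf (r : 'S_s) : size [seq r a | a <- rev (enum 'I_s)] ==
    size (rev [seq u a | a <- enum 'I_s]).
  by rewrite szu size_map size_rev size_enum_ord.
pose f r := Tuple (szf r).
have f_inj : injective f.
  move=> r r' /(congr1 val)/= /eq_in_map rr'; apply/permP => a; apply: rr'.
  by rewrite mem_rev mem_enum.
have fuP (tau : (size (rev [seq u a | a <- enum 'I_s])).-tuple 'I_s) :
    uniq tau && all (mem [set: 'I_s]%SET) tau -> exists r, f r = tau.
  move=> /andP[tauU _].
  have szt : size (rev tau) == s by rewrite size_rev size_tuple szu.
  (* A repetition-free tuple of length [s] exhausts ['I_s], so it is a rearrangement of the identity
     tuple. *)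
  have : perm_eq (Tuple szt) (ord_tuple s).
    apply: uniq_perm; rewrite ?rev_uniq ?enum_uniq //= => a.
    have sub : {subset rev tau <= enum 'I_s} by move=> y _; rewrite mem_enum.
    have le_sz : (size (enum 'I_s) <= size (rev tau))%N.
      by rewrite (eqP szt) size_enum_ord.
    have tauU' : uniq (rev tau) by rewrite rev_uniq.
    by have [_ ->] := uniq_min_size tauU' sub le_sz.
  move=> /tuple_permP[r /= rE]; exists r; apply: val_inj => /=.
  rewrite map_rev -[RHS]revK rE; congr rev.
  by apply: eq_map => a; rewrite tnth_ord_tuple.
(* The default [1%g] only makes the inverse of [f] total; the tuples of the sum all come from a
   permutation. *)
rewrite (reindex_onto f (fun tau => odflt 1%g [pick r | f r == tau])); last first.
  move=> tau /fuP[r <-]; case: pickP => [r' /eqP//|/(_ r)]; by rewrite eqxx.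
apply: eq_big => r.
  rewrite /= map_inj_uniq ?rev_uniq ?enum_uniq; last exact: perm_inj.
  rewrite (introT allP) /=; last by move=> a; rewrite inE.
  case: pickP => [r' /eqP/f_inj ->|/(_ r)]; by rewrite ?eqxx.
(* The leftover product is empty: a permutation takes every value. *)
move=> _; rewrite [X in _ * X]big1 ?mulr1 => [|a].
  rewrite /= -map_rev zip_map big_map /= (perm_big (enum 'I_s)) ?big_enum //.
  by rewrite perm_rev.
rewrite inE /=; case/negP; apply/mapP; exists ((r^-1)%g a).
  by rewrite mem_rev mem_enum.
by rewrite permKV.
Qed.

(** * The coefficients as signed sums, and their invariance *)

Section FormDeterminant.
Variable R : realType.

(** A signed analogue of the determinant for a three-way array, symmetric in [i] and alternating in
    [i'] and in [i'']. The index types are arbitrary, so that it applies both to vectors and to the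
    indices of basis vectors. *)
Definition form_det (I1 I2 I3 : Type) (q : I1 -> I2 -> I3 -> R) s
    (i : 'I_s -> I1) (i' : 'I_s -> I2) (i'' : 'I_s -> I3) : R :=
  \sum_(r : 'S_s) \sum_(p : 'S_s)
    (-1) ^+ r * (-1) ^+ p * \prod_a q (i a) (i' (r a)) (i'' (p a)).

Lemma derive_QdetE d1 k d (Q : triform R d1 k d) s (u : 'I_s -> 'cV[R]_d1)
    (v : 'I_s -> 'cV[R]_k) (w : 'I_s -> 'cV[R]_d) :
  trilinear Q -> derive_Qdet Q u v w = form_det Q u v w.
Proof.
case=> Q1 _ _; rewrite /derive_Qdet.
have -> : (fun t => Qdet Q t v w) =
    (fun t => \sum_(p : 'S_s) (-1) ^+ p * \prod_a Q t (v a) (w (p a))).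
  apply/funext => t; rewrite /Qdet; apply: eq_bigr => p _; congr (_ * _).
  by apply: eq_bigr => a _; rewrite mxE.
rewrite (@iter_derive_prod_scalar _ _ _ u _ (fun p : 'S_s => (-1) ^+ p)
  (fun p a t => Q t (v a) (w (p a)))) => [|p a]; last exact: Q1.
under eq_bigr do rewrite mulr_sumr.
rewrite exchange_big; apply: eq_bigr => r _ /=.
(* The third argument carries the composite of [r] and [p]; this substitution makes the two
   permutations independent and moves the sign of [r] into the sum. *)
rewrite (reindex_inj (mulgI r^-1%g)) /=; apply: eq_bigr => p _.
rewrite odd_permM odd_permV signr_addb; congr (_ * _).
by apply: eq_bigr => a _; rewrite permM permK.
Qed.

Lemma form_det_swap (I1 I2 I3 : Type) (q : I1 -> I2 -> I3 -> R) s
    (i : 'I_s -> I1) (i' : 'I_s -> I2) (i'' : 'I_s -> I3) :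
  form_det q i i' i'' = form_det (fun x z y => q x y z) i i'' i'.
Proof.
rewrite /form_det exchange_big; apply: eq_bigr => r _; apply: eq_bigr => p _.
by rewrite [(-1) ^+ p * _]mulrC.
Qed.

Lemma form_detZ (I1 I2 I3 : Type) (q : I1 -> I2 -> I3 -> R)
    (f : I1 -> R) (g : I2 -> R) (h : I3 -> R) s
    (i : 'I_s -> I1) (i' : 'I_s -> I2) (i'' : 'I_s -> I3) :
  form_det (fun x y z => f x * g y * h z * q x y z) i i' i'' =
  (\prod_a f (i a)) * (\prod_a g (i' a)) * (\prod_a h (i'' a))
    * form_det q i i' i''.
Proof.
rewrite /form_det mulr_sumr; apply: eq_bigr => r _.
rewrite mulr_sumr; apply: eq_bigr => p _; rewrite !big_split /= mulrCA.
congr (_ * _ * _ * _).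
  by rewrite [RHS](reindex_inj (@perm_inj _ r)).
by rewrite [RHS](reindex_inj (@perm_inj _ p)).
Qed.

(** Multilinearity: a product of sums is expanded into a sum over all choice functions. *)
Lemma form_det_mix1 (I1 : finType) (I2 I3 : Type) (q : I1 -> I2 -> I3 -> R)
    (V : I1 -> I1 -> R) s (i : 'I_s -> I1) (i' : 'I_s -> I2) (i'' : 'I_s -> I3) :
  form_det (fun x y z => \sum_l V l x * q l y z) i i' i'' =
  \sum_(l : {ffun 'I_s -> I1}) (\prod_a V (l a) (i a)) * form_det q l i' i''.
Proof.
rewrite /form_det.
under [RHS]eq_bigr do rewrite mulr_sumr.
rewrite [RHS]exchange_big; apply: eq_bigr => r _ /=.
under [RHS]eq_bigr do rewrite mulr_sumr.
rewrite [RHS]exchange_big; apply: eq_bigr => p _ /=.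
rewrite (bigA_distr_bigA (fun a l => V l (i a) * q l (i' (r a)) (i'' (p a)))) /=.
rewrite mulr_sumr; apply: eq_bigr => l _.
by rewrite big_split /= mulrCA.
Qed.

Lemma form_det_mix2 (I2 : finType) (I1 I3 : Type) (q : I1 -> I2 -> I3 -> R)
    (V : I2 -> I2 -> R) s (i : 'I_s -> I1) (i' : 'I_s -> I2) (i'' : 'I_s -> I3) :
  form_det (fun x y z => \sum_l V l y * q x l z) i i' i'' =
  \sum_(l : {ffun 'I_s -> I2}) (\prod_a V (l a) (i' a)) * form_det q i l i''.
Proof.
rewrite /form_det.
under [RHS]eq_bigr do rewrite mulr_sumr.
rewrite [RHS]exchange_big; apply: eq_bigr => r _ /=.
under [RHS]eq_bigr do rewrite mulr_sumr.
rewrite [RHS]exchange_big; apply: eq_bigr => p _ /=.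
rewrite (bigA_distr_bigA (fun a l => V l (i' (r a)) * q (i a) l (i'' (p a)))) /=.
(* Here the choice function is attached to [r a], not to [a]; precomposing it with [r] makes the
   weights independent of [r]. *)
pose h (t : 'S_s) (l : {ffun 'I_s -> I2}) := [ffun a => l (t a)].
rewrite (reindex (h r)) /=; last first.
  by exists (h r^-1%g) => l _; apply/ffunP => a; rewrite !ffunE ?permK ?permKV.
rewrite mulr_sumr; apply: eq_bigr => l _.
rewrite big_split /= mulrCA; congr (_ * (_ * _)).
  rewrite [RHS](reindex_inj (@perm_inj _ r)).
  by apply: eq_bigr => a _; rewrite ffunE.
by apply: eq_bigr => a _; rewrite ffunE.
Qed.

Lemma form_det_mix3 (I3 : finType) (I1 I2 : Type) (q : I1 -> I2 -> I3 -> R)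
    (V : I3 -> I3 -> R) s (i : 'I_s -> I1) (i' : 'I_s -> I2) (i'' : 'I_s -> I3) :
  form_det (fun x y z => \sum_l V l z * q x y l) i i' i'' =
  \sum_(l : {ffun 'I_s -> I3}) (\prod_a V (l a) (i'' a)) * form_det q i i' l.
Proof.
rewrite form_det_swap (form_det_mix2 (fun x z y => q x y z)).
by apply: eq_bigr => l _; rewrite -form_det_swap.
Qed.

(** The s-fold tensor power of an orthogonal matrix is orthogonal, so it preserves sums of
    squares. *)
Lemma sum_sqr_mix (I : finType) s (V : I -> I -> R) (F : {ffun 'I_s -> I} -> R) :
  (forall j j', \sum_i V j i * V j' i = (j == j')%:R) ->
  \sum_(i : {ffun 'I_s -> I})
    (\sum_(j : {ffun 'I_s -> I}) (\prod_a V (j a) (i a)) * F j) ^+ 2 =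
  \sum_j F j ^+ 2.
Proof.
move=> VV.
under eq_bigr do rewrite expr2 mulr_suml.
rewrite exchange_big /=; apply: eq_bigr => j _.
under eq_bigr do rewrite mulr_sumr.
rewrite exchange_big /= (bigD1 j) //= [X in _ + X]big1 ?addr0 => [|j' j'j].
  transitivity ((\prod_(a : 'I_s) \sum_i V (j a) i * V (j a) i) * F j ^+ 2).
    rewrite (bigA_distr_bigA (fun a i => V (j a) i * V (j a) i)) /= mulr_suml.
    by apply: eq_bigr => i _; rewrite big_split /= mulrACA.
  by rewrite big1 ?mul1r // => a _; rewrite VV eqxx.
transitivity ((\prod_(a : 'I_s) \sum_i V (j a) i * V (j' a) i) * (F j * F j')).
  rewrite (bigA_distr_bigA (fun a i => V (j a) i * V (j' a) i)) /= mulr_suml.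
  by apply: eq_bigr => i _; rewrite big_split /= mulrACA.
have [a ja] : exists a, j a != j' a.
  apply/existsP; rewrite -negb_forall; apply: contra j'j => /forallP jj.
  by apply/eqP/ffunP => a; rewrite (eqP (jj a)).
by rewrite (bigD1 a) //= VV (negbTE ja) !mul0r.
Qed.

Lemma cvg_form_det (T I1 I2 I3 : Type) (F : set_system T) (FF : Filter F)
    (q : T -> I1 -> I2 -> I3 -> R) (q0 : I1 -> I2 -> I3 -> R) s
    (i : 'I_s -> I1) (i' : 'I_s -> I2) (i'' : 'I_s -> I3) :
  (forall x y z, q t x y z @[t --> F] --> q0 x y z) ->
  form_det (q t) i i' i'' @[t --> F] --> form_det q0 i i' i''.
Proof.
move=> qq0; apply: cvg_big => [|r _]; first exact: add_continuous.
apply: cvg_big => [|p _]; first exact: add_continuous.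
apply: cvgM; first exact: cvg_cst.
by apply: cvg_big => [|a _]; [exact: mul_continuous|exact: qq0].
Qed.

Variables (d1 k d : nat) (Q : triform R d1 k d).
Hypothesis triQ : trilinear Q.

Definition sum_sqr (q : 'I_d1 -> 'I_k -> 'I_d -> R) : R :=
  \sum_(1 <= s < (minn d k).+1)
    \sum_(i : {ffun 'I_s -> 'I_d1}) \sum_(i' : {ffun 'I_s -> 'I_k})
    \sum_(i'' : {ffun 'I_s -> 'I_d}) form_det q i i' i'' ^+ 2.

Lemma calQE u v w :
  calQ Q u v w = Num.sqrt (1 + sum_sqr (fun x y z => Q (u x) (v y) (w z))).
Proof.
congr (Num.sqrt (1 + _)); apply: eq_bigr => s _.
apply: eq_bigr => i _; apply: eq_bigr => i' _; apply: eq_bigr => i'' _.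
by rewrite derive_QdetE // real_normK ?num_real.
Qed.

Lemma sum_sqr_mix1 (V : 'I_d1 -> 'I_d1 -> R) q :
  (forall j j', \sum_i V j i * V j' i = (j == j')%:R) ->
  sum_sqr (fun x y z => \sum_l V l x * q l y z) = sum_sqr q.
Proof.
move=> VV; apply: eq_bigr => s _.
rewrite exchange_big [RHS]exchange_big; apply: eq_bigr => i' _ /=.
rewrite exchange_big [RHS]exchange_big; apply: eq_bigr => i'' _ /=.
under eq_bigr do rewrite form_det_mix1.
exact: (@sum_sqr_mix _ _ _ (fun i : {ffun _ -> _} => form_det q i i' i'')).
Qed.

Lemma sum_sqr_mix2 (V : 'I_k -> 'I_k -> R) q :
  (forall j j', \sum_i V j i * V j' i = (j == j')%:R) ->
  sum_sqr (fun x y z => \sum_l V l y * q x l z) = sum_sqr q.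
Proof.
move=> VV; apply: eq_bigr => s _; apply: eq_bigr => i _.
rewrite exchange_big [RHS]exchange_big; apply: eq_bigr => i'' _ /=.
under eq_bigr do rewrite form_det_mix2.
exact: (@sum_sqr_mix _ _ _ (fun i' : {ffun _ -> _} => form_det q i i' i'')).
Qed.

Lemma sum_sqr_mix3 (V : 'I_d -> 'I_d -> R) q :
  (forall j j', \sum_i V j i * V j' i = (j == j')%:R) ->
  sum_sqr (fun x y z => \sum_l V l z * q x y l) = sum_sqr q.
Proof.
move=> VV; apply: eq_bigr => s _; apply: eq_bigr => i _.
apply: eq_bigr => i' _.
under eq_bigr do rewrite form_det_mix3.
exact: (@sum_sqr_mix _ _ _ (fun i'' : {ffun _ -> _} => form_det q i i' i'')).
Qed.

Lemma scalar_fun0 n (f : 'cV[R]_n -> R) : scalar f -> f 0 = 0.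
Proof. by move=> lf; have := lf (-1) 0 0; rewrite scaler0 addr0 mulN1r addNr. Qed.

Lemma scalar_funZ n (f : 'cV[R]_n -> R) c x : scalar f -> f (c *: x) = c * f x.
Proof. by move=> lf; rewrite -[c *: x]addr0 lf (scalar_fun0 lf) addr0. Qed.

Lemma scalar_fun_sum (I : finType) n (f : 'cV[R]_n -> R) (c : I -> R)
    (x : I -> 'cV[R]_n) :
  scalar f -> f (\sum_l c l *: x l) = \sum_l c l * f (x l).
Proof.
by move=> lf; elim/big_rec2: _ => [|l y z _ <-]; rewrite ?lf ?(scalar_fun0 lf).
Qed.

(** This invariance is what allows each basis to be replaced by the orthogonal vectors of its
    singular value decomposition. *)
Lemma calQ_mix (V1 : 'I_d1 -> 'I_d1 -> R) (V2 : 'I_k -> 'I_k -> R)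
    (V3 : 'I_d -> 'I_d -> R) u v w :
  (forall j j', \sum_i V1 j i * V1 j' i = (j == j')%:R) ->
  (forall j j', \sum_i V2 j i * V2 j' i = (j == j')%:R) ->
  (forall j j', \sum_i V3 j i * V3 j' i = (j == j')%:R) ->
  calQ Q (fun i => \sum_l V1 l i *: u l) (fun i => \sum_l V2 l i *: v l)
    (fun i => \sum_l V3 l i *: w l) = calQ Q u v w.
Proof.
move=> V11 V22 V33; rewrite !calQE.
rewrite -[in RHS](sum_sqr_mix3 _ V33) -[in RHS](sum_sqr_mix2 _ V22).
rewrite -[in RHS](sum_sqr_mix1 _ V11).
congr (Num.sqrt (1 + sum_sqr _)).
apply/funext => x; apply/funext => y; apply/funext => z.
case: triQ => Q1 Q2 Q3 /=; rewrite (scalar_fun_sum _ _ (Q1 _ _)).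
apply: eq_bigr => l _; congr (_ * _); rewrite (scalar_fun_sum _ _ (Q2 _ _)).
by apply: eq_bigr => l' _; congr (_ * _); rewrite (scalar_fun_sum _ _ (Q3 _ _)).
Qed.

Lemma form_det_le_calQ s (i : 'I_s -> 'I_d1) (i' : 'I_s -> 'I_k)
    (i'' : 'I_s -> 'I_d) u v w : (0 < s <= minn d k)%N ->
  `|form_det (fun x y z => Q (u x) (v y) (w z)) i i' i''| <= calQ Q u v w.
Proof.
move=> /andP[s0 sdk]; rewrite calQE -sqrtr_sqr ler_wsqrtr // ler_wpDl //.
rewrite /sum_sqr (bigD1_seq s) ?iota_uniq //=; last first.
  by rewrite mem_index_iota s0 ltnS.
have ffE n (j : 'I_s -> 'I_n) : j = [ffun a => j a].
  by apply/funext => a; rewrite ffunE.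
rewrite (ffE _ i) (ffE _ i') (ffE _ i'').
rewrite (bigD1 [ffun a => i a]) //= (bigD1 [ffun a => i' a]) //=.
rewrite (bigD1 [ffun a => i'' a]) //= -!addrA lerDl.
by rewrite !addr_ge0 //; do !(apply: sumr_ge0 => ? _); exact: sqr_ge0.
Qed.

Lemma calQ_ge1 u v w : 1 <= calQ Q u v w.
Proof.
rewrite calQE -[leLHS]sqrtr1 ler_wsqrtr // lerDl.
by do !(apply: sumr_ge0 => ? _); exact: sqr_ge0.
Qed.

End FormDeterminant.

(** * Orthogonal matrices and singular values *)

Section OrthogonalMatrices.
Variable R : realType.

Lemma cvg_mx (T : Type) (F : set_system T) (FF : Filter F) m n
    (f : T -> 'M[R]_(m, n)) (A : 'M[R]_(m, n)) :
  (forall i j, f t i j @[t --> F] --> A i j) -> f @ F --> A.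
Proof.
move=> fA B [P nP sPB]; rewrite /nbhs /= /nbhs /=.
have : \forall t \near F, forall i j, P i j (f t i j).
  apply: filter_forall => i; apply: filter_forall => j; exact: fA (nP i j).
by apply: filterS => t Pt; apply: sPB.
Qed.

Lemma mulmx_continuous_comp (T : topologicalType) m n p (f : T -> 'M[R]_(m, n))
    (g : T -> 'M[R]_(n, p)) :
  continuous f -> continuous g -> continuous (fun t => f t *m g t).
Proof.
move=> cf cg t; apply: cvg_mx => i j.
rewrite (_ : (fun t => _) = fun t => \sum_l f t i l * g t l j); last first.
  by apply/funext => y; rewrite mxE.
rewrite mxE; apply: cvg_big => [|l _]; first exact: add_continuous.
exact: (cvgM (continuous_comp (cf t) (@coord_continuous _ _ _ i l (f t)))
  (continuous_comp (cg t) (@coord_continuous _ _ _ l j (g t)))).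
Qed.

Lemma trmx_continuous m n : continuous (@trmx R m n).
Proof.
move=> A; apply: (@cvg_mx _ (nbhs A)) => i j; rewrite mxE.
rewrite (_ : (fun t : 'M[R]_(m, n) => _) = fun t => t j i); last first.
  by apply/funext => y; rewrite mxE.
exact: coord_continuous.
Qed.

(** The matrices with entries in [-1, 1] are the continuous image under [vec_mx] of a compact cube
    of row vectors. *)
Lemma compact_mx_le1 m n (A : set 'M[R]_(m, n)) :
  closed A -> (forall M, A M -> forall i j, `|M i j| <= 1) -> compact A.
Proof.
move=> clA A1.
pose B := [set v : 'rV[R]_(m * n) | forall i, `[(-1 : R), 1]%classic (v ord0 i)].
have cB : compact B.
  apply: (@rV_compact _ _ (fun=> `[(-1 : R), 1]%classic)) => _.
  exact: segment_compact.
have cvec : continuous (@vec_mx R m n).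
  move=> v; apply: (@cvg_mx _ (nbhs v)) => i j; rewrite mxE.
  rewrite (_ : (fun t : 'rV[R]_(m * n) => _) = fun t => t 0 (mxvec_index i j));
    last by apply/funext => y; rewrite mxE.
  exact: coord_continuous.
apply: (subclosed_compact clA (continuous_compact _ cB)) => [|M AM].
  exact: continuous_subspaceT.
exists (mxvec M); last exact: mxvecK.
move=> l; case/mxvec_indexP: l => i j.
by rewrite /= mxvecE in_itv /= -ler_norml A1.
Qed.

(** * The orthogonal group and orthonormal bases *)

Definition orthogonal_mx n : set 'M[R]_n := [set O | O^T *m O = 1%:M].

Lemma orthogonal_mxP n (O : 'M[R]_n) : orthogonal_mx O <->
  forall i j, \sum_l O l i * O l j = (i == j)%:R.
Proof.
split=> [/matrixP OO i j|OO].
  by have := OO i j; rewrite !mxE => <-; apply: eq_bigr => l _; rewrite mxE.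
apply/matrixP => i j; rewrite !mxE -OO; apply: eq_bigr => l _.
by rewrite mxE.
Qed.

Lemma orthogonal_mx_rows n (O : 'M[R]_n) : orthogonal_mx O ->
  forall i j, \sum_l O i l * O j l = (i == j)%:R.
Proof.
move=> /mulmx1C /matrixP OO i j.
by have := OO i j; rewrite !mxE => <-; apply: eq_bigr => l _; rewrite mxE.
Qed.

(** Closed as the preimage of [1%:M]; bounded because the columns are unit vectors. *)
Lemma orthogonal_mx_compact n : compact (@orthogonal_mx n).
Proof.
apply: compact_mx_le1 => [|O OO i j].
  apply: (@preimage_closed _ _ (fun O : 'M[R]_n => O^T *m O) [set 1%:M]).
    move=> A _; apply: mulmx_continuous_comp; first exact: trmx_continuous.
    by move=> ?; exact: cvg_id.
  exact/accessible_closed_set1/hausdorff_accessible/norm_hausdorff.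
have := orthogonal_mxP O => -[/(_ OO j j) + _].
rewrite eqxx => /(congr1 (fun x => x - 1)); rewrite subrr => O1.
rewrite -(ler_pXn2r (n := 2)) ?nnegrE // expr1n real_normK ?num_real //.
rewrite -subr_le0 -O1 lerD2r (bigD1 i) //= expr2 lerDl.
by apply: sumr_ge0 => l _; rewrite -expr2 sqr_ge0.
Qed.

Lemma det_orthogonal_mx n (O : 'M[R]_n) : orthogonal_mx O -> `|\det O| = 1.
Proof.
move=> /(congr1 determinant); rewrite det_mulmx det_tr det1 -expr2 => d1.
by apply/eqP; rewrite -(@eqrXn2 _ 2) // expr1n real_normK ?num_real // d1.
Qed.

Definition basis_mx n (u : 'I_n -> 'cV[R]_n) : 'M[R]_n := \matrix_(l, i) u i l 0.

Lemma basis_mx_mulE n (u : 'I_n -> 'cV[R]_n) (c : 'cV[R]_n) :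
  basis_mx u *m c = \sum_i c i 0 *: u i.
Proof.
apply/colP => l; rewrite mxE summxE; apply: eq_bigr => i _.
by rewrite !mxE mulrC.
Qed.

Lemma is_basisP n (u : 'I_n -> 'cV[R]_n) : is_basis u <-> basis_det u != 0.
Proof.
pose X := [tuple u i | i < n].
have XE : [seq u i | i <- enum 'I_n] = X :> seq _ by [].
have Xi (i : 'I_n) : X`_i = u i by rewrite -tnth_nth tnth_mktuple.
split=> [|du].
  rewrite /is_basis basisEfree => /andP[/(@freeP _ _ _ X) fX _].
  apply/negP => /eqP; rewrite /basis_det -det_tr => /eqP/det0P[c c0 cu].
  case/eqP: c0; apply/rowP => i; rewrite [RHS]mxE; apply: (fX (c 0)).
  transitivity (basis_mx u *m c^T).
    by rewrite basis_mx_mulE; apply: eq_bigr => j _; rewrite Xi mxE.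
  by rewrite -[LHS]trmxK trmx_mul trmxK cu trmx0.
rewrite /is_basis basisEfree subvf dimvf /= size_map size_enum_ord.
have -> : (dim 'cV[R]_n <= n)%N by rewrite /dim /= muln1.
rewrite !andbT XE; apply/freeP => c cX.
have Bu : basis_mx u \in unitmx by rewrite unitmxE unitfE.
suff c0 : (\col_i c i) = 0 :> 'cV[R]_n.
  by move=> i; have /colP/(_ i) := c0; rewrite !mxE.
rewrite -[LHS](mulKmx Bu) basis_mx_mulE [X in _ *m X](_ : _ = 0) ?mulmx0 //.
by rewrite -[RHS]cX; apply: eq_bigr => i _; rewrite Xi mxE.
Qed.

Lemma orthonormal_basisP n (u : 'I_n -> 'cV[R]_n) :
  orthonormal_basis u <-> orthogonal_mx (basis_mx u).
Proof.
have sumE i j : \sum_l basis_mx u l i * basis_mx u l j =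
    \sum_(l < n) u i l 0 * u j l 0 by apply: eq_bigr => l _; rewrite !mxE.
split=> [[_ uu]|/[dup] oB /orthogonal_mxP uu].
  by apply/orthogonal_mxP => i j; rewrite sumE.
split=> [|i j]; last by rewrite -sumE.
by apply/is_basisP; rewrite -normr_gt0 (det_orthogonal_mx oB).
Qed.

Lemma col_basis_mx n (u : 'I_n -> 'cV[R]_n) : u = (fun i => col i (basis_mx u)).
Proof. by apply/funext => i; apply/colP => l; rewrite !mxE. Qed.

Lemma basis_mx_col n (O : 'M[R]_n) : basis_mx (fun i => col i O) = O.
Proof. by apply/matrixP => i j; rewrite !mxE. Qed.

(** First-order condition at a maximum: for small [e] of the sign of [X] the linear term would win.
    With [e] = X / c the left side is (X / c)^2 (2 c + Y), and the choice of [c] makes the second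
    factor positive. *)
Lemma quadratic_le0 (X Y : R) :
  (forall e, 2 * e * X + e ^+ 2 * Y <= 0) -> X = 0.
Proof.
move=> H; pose c := `|Y| + 1.
have c0 : 0 < c by rewrite ltr_wpDl.
have Yc : 0 < 2 * c + Y.
  have : - Y <= `|Y| by rewrite -normrN ler_norm.
  rewrite /c; have := normr_ge0 Y; lra.
have := H (X / c).
have -> : 2 * (X / c) * X + (X / c) ^+ 2 * Y = (X / c) ^+ 2 * (2 * c + Y).
  by field; rewrite gt_eqF.
rewrite pmulr_lle0 // => X0.
have : (X / c) ^+ 2 == 0 by rewrite eq_le X0 sqr_ge0.
by rewrite sqrf_eq0 mulf_eq0 invr_eq0 (gt_eqF c0) orbF => /eqP.
Qed.

(** * Plane rotations and their effect on Gram matrices *)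

Section TwoTermColumns.
Variables (n : nat) (al be : 'I_n -> R) (phi psi : 'I_n -> 'I_n).

(** Right multiplication by a matrix with at most two nonzero entries in each column. Written
    columnwise, it visibly commutes with left multiplication, and a new Gram entry is a combination
    of four old ones. *)
Definition two_term_columns (W : 'M[R]_n) : 'M[R]_n :=
  \matrix_(l, i) (al i * W l (phi i) + be i * W l (psi i)).

Lemma mul_two_term_columns (A W : 'M[R]_n) :
  A *m two_term_columns W = two_term_columns (A *m W).
Proof.
apply/matrixP => l i; rewrite !mxE !mulr_sumr -big_split /=.
by apply: eq_bigr => m _; rewrite mxE; ring.
Qed.

Lemma gram_two_term_columns (W : 'M[R]_n) (g : 'I_n -> 'I_n -> R) :
  (forall i j, \sum_l W l i * W l j = g i j) -> forall i j,
  \sum_l two_term_columns W l i * two_term_columns W l j =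
  al i * al j * g (phi i) (phi j) + al i * be j * g (phi i) (psi j) +
  be i * al j * g (psi i) (phi j) + be i * be j * g (psi i) (psi j).
Proof.
move=> gE i j; rewrite -!gE !mulr_sumr -!big_split /=.
by apply: eq_bigr => l _; rewrite !mxE; ring.
Qed.

End TwoTermColumns.

Section PlaneRotation.
Variables (n : nat) (p q : 'I_n) (e : R).
Hypothesis pq : p != q.

Let c : R := (Num.sqrt (1 + e ^+ 2))^-1.

Let c2 : c ^+ 2 * (1 + e ^+ 2) = 1.
Proof.
have e2 : 0 < 1 + e ^+ 2 by rewrite ltr_pwDl // sqr_ge0.
by rewrite /c exprVn sqr_sqrtr ?ltW // mulVf ?gt_eqF.
Qed.

(** [e] is the tangent of the angle, [c] its cosine and [c * e] its sine, so that up to [c ^+ 2] all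
    changes are polynomial in [e]. For a column other than [p] and [q] the second coefficient is 0
    and the index [p] there is a dummy. *)
Definition plane_rotation : 'M[R]_n -> 'M[R]_n :=
  two_term_columns
    (fun i => if i == p then c else if i == q then c else 1)
    (fun i => if i == p then c * e else if i == q then - (c * e) else 0)
    id (fun i => if i == p then q else p).

Lemma plane_rotation_orthogonal W :
  orthogonal_mx W -> orthogonal_mx (plane_rotation W).
Proof.
move=> /orthogonal_mxP WW; apply/orthogonal_mxP => i j.
rewrite (gram_two_term_columns _ _ _ _ WW).
have qp : (q == p) = false by rewrite eq_sym (negbTE pq).
have pq' := negbTE pq.
have [->|/negbTE ip] := eqVneq i p; have [->|/negbTE jp] := eqVneq j p;
  rewrite ?eqxx ?pq' ?qp ?ip ?jp ?(eq_sym p) ?jp /=.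
- by rewrite -[RHS]c2; ring.
- have [_|/negbTE jq] := eqVneq j q;
    rewrite ?qp ?jq ?(eq_sym q) ?jq ?eqxx ?pq' /=; ring.
- have [_|/negbTE iq] := eqVneq i q; rewrite ?qp ?iq ?eqxx ?pq' /=; ring.
have [->|/negbTE iq] := eqVneq i q; rewrite ?eqxx ?pq' ?qp /=.
  have [_|/negbTE jq] := eqVneq j q; rewrite ?eqxx ?pq' ?qp ?jq /=; last by ring.
  by rewrite -[RHS]c2; ring.
by have [->|/negbTE jq] := eqVneq j q; rewrite ?iq ?(eq_sym q) ?iq /=; ring.
Qed.

(** Only the columns [p] and [q] contribute to the change, which has the quadratic shape of
    [quadratic_le0] up to the positive factor [c ^+ 2]. *)
Lemma plane_rotation_gram W (f : 'I_n -> R) :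
  \sum_i f i * \sum_l plane_rotation W l i ^+ 2 =
  \sum_i f i * \sum_l W l i ^+ 2
  + c ^+ 2 * (2 * e * ((f p - f q) * \sum_l W l p * W l q) + e ^+ 2 *
     ((f p - f q) * (\sum_l W l q ^+ 2 - \sum_l W l p ^+ 2))).
Proof.
pose g i j := \sum_l W l i * W l j.
have gP i : \sum_l plane_rotation W l i ^+ 2 = _ :=
  gram_two_term_columns _ _ _ _ (fun i j => erefl (g i j)) i i.
have gs i : \sum_l W l i ^+ 2 = g i i by [].
have gC : g q p = g p q by apply: eq_bigr => l _; rewrite mulrC.
have qp : (q == p) = false by rewrite eq_sym (negbTE pq).
under eq_bigr do rewrite gP.
under [X in _ = X + _]eq_bigr do rewrite gs.
rewrite !gs -/(g p q) (bigD1 p) // (bigD1 q) ?qp //=.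
rewrite [in RHS](bigD1 p) // [in RHS](bigD1 q) ?qp //=.
rewrite !eqxx gC.
set S := (X in _ + (_ + X) = _); set S' := (X in _ = _ + (_ + X) + _).
have -> : S = S'.
  apply: eq_bigr => i /andP[/negbTE ip /negbTE iq].
  by rewrite ip iq; ring.
apply/eqP; rewrite -subr_eq0; apply/eqP.
(* The two sides differ by a multiple of cos^2 + sin^2 - 1. *)
transitivity ((c ^+ 2 * (1 + e ^+ 2) - 1) * (f p * g p p + f q * g q q)).
  by ring.
by rewrite c2 subrr mul0r.
Qed.

End PlaneRotation.

(* At a maximum over O(n) of [V |-> \sum_i i |A V e_i|^2], the first variation
   along the rotation of the plane (e_p, e_q) is [2 (p - q) <A V e_p, A V e_q>],
   so the columns of [A V] are orthogonal. *)
Lemma exists_orthogonal_columns n (A : 'M[R]_n) :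
  exists2 V, orthogonal_mx V &
    forall p q, p != q -> \sum_l (A *m V) l p * (A *m V) l q = 0.
Proof.
pose F (V : 'M[R]_n) := \sum_(i < n) i%:R * \sum_l (A *m V) l i ^+ 2 : R.
have cF : continuous F.
  move=> V; apply: (@cvg_big _ _ _ _ _ _ _ (nbhs V)) => [|i _].
    exact: add_continuous.
  apply: (@cvgM _ _ (nbhs V)); first exact: cvg_cst.
  apply: (@cvg_big _ _ _ _ _ _ _ (nbhs V)) => [|l _].
    exact: add_continuous.
  have cAV : (fun W : 'M[R]_n => (A *m W) l i) @ V --> (A *m V) l i.
    have cA : continuous (fun W : 'M[R]_n => A *m W).
      by apply: mulmx_continuous_comp => W; [exact: cst_continuous|exact: cvg_id].
    exact: (continuous_comp (cA V) (@coord_continuous _ _ _ l i _)).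
  exact: (cvgM cAV cAV).
have O0 : @orthogonal_mx n !=set0.
  by exists 1%:M; rewrite /orthogonal_mx /= trmx1 mul1mx.
have [V /set_mem oV maxV] := compact_EVT_max O0 (@orthogonal_mx_compact n)
  (continuous_subspaceT cF).
exists V => // p q pq.
(* The weights of the columns in [F] are pairwise distinct, so their difference can be cancelled. *)
have pq0 : (p%:R - q%:R : R) != 0.
  by rewrite subr_eq0 eqr_nat.
apply: (mulfI pq0); rewrite mulr0; apply: quadratic_le0 => e.
have /maxV : plane_rotation p q e V \in @orthogonal_mx n.
  by apply/mem_set/plane_rotation_orthogonal.
rewrite /F mul_two_term_columns plane_rotation_gram // gerDl pmulr_rle0; first exact.
by rewrite exprn_gt0 // invr_gt0 sqrtr_gt0 ltr_pwDl // sqr_ge0.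
Qed.

(** The rotated vectors are orthogonal; their norms are the singular values, positive because the
    determinant is nonzero, and normalizing gives the columns of [O]. *)
Lemma singular_value_decomposition n (u : 'I_n -> 'cV[R]_n) : is_basis u ->
  exists V O : 'M[R]_n, exists sg : 'I_n -> R,
    [/\ orthogonal_mx V, orthogonal_mx O, forall i, 0 < sg i &
        forall i, \sum_l V l i *: u l = sg i *: col i O].
Proof.
move=> /is_basisP du; have [V oV AV] := exists_orthogonal_columns (basis_mx u).
have [W WE] : exists W, W = basis_mx u *m V by exists (basis_mx u *m V).
rewrite -WE in AV.
have dW : \det W != 0.
  rewrite WE det_mulmx mulf_neq0 // -normr_gt0.
  by rewrite det_orthogonal_mx.
have W0 i : 0 < \sum_l W l i ^+ 2.
  rewrite lt_neqAle sumr_ge0 ?andbT => [|l _]; last exact: sqr_ge0.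
  apply: contraNneq dW => /esym/eqP.
  rewrite psumr_eq0 => [/allP Wi|l _]; last exact: sqr_ge0.
  rewrite (expand_det_col _ i) big1 // => l _.
  by have := Wi l (mem_index_enum l); rewrite /= sqrf_eq0 => /eqP ->; rewrite mul0r.
pose sg i := Num.sqrt (\sum_l W l i ^+ 2).
have sg0 i : 0 < sg i by rewrite sqrtr_gt0.
exists V, (\matrix_(l, i) (W l i / sg i)), sg; split=> // [|i].
  apply/orthogonal_mxP => i j; under eq_bigr do rewrite !mxE mulrACA -invfM.
  rewrite -mulr_suml; case: eqVneq => [<-|ij]; last by rewrite AV ?mul0r.
  rewrite -expr2 sqr_sqrtr ?ltW //; under eq_bigr do rewrite -expr2.
  by rewrite divff ?gt_eqF.
apply/colP => l; rewrite !mxE mulrCA divff ?gt_eqF // mulr1 WE mxE summxE.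
by apply: eq_bigr => m _; rewrite !mxE mulrC.
Qed.

Lemma basis_det_scale n (O : 'M[R]_n) (sg : 'I_n -> R) :
  basis_det (fun i => sg i *: col i O) = \det O * \prod_i sg i.
Proof.
have -> : \prod_i sg i = \det (diag_mx (\row_i sg i)).
  by rewrite det_diag; apply: eq_bigr => i _; rewrite mxE.
rewrite -det_mulmx; congr determinant; apply/matrixP => l i.
by rewrite mul_mx_diag !mxE mulrC.
Qed.

Lemma basis_det_mix n (V : 'M[R]_n) (u : 'I_n -> 'cV[R]_n) : orthogonal_mx V ->
  `|basis_det (fun i => \sum_l V l i *: u l)| = `|basis_det u|.
Proof.
move=> oV.
have -> : basis_det (fun i => \sum_l V l i *: u l) = \det (basis_mx u *m V).
  congr determinant; apply/matrixP => l i; rewrite !mxE summxE.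
  by apply: eq_bigr => m _; rewrite !mxE mulrC.
by rewrite det_mulmx normrM (det_orthogonal_mx oV) mulr1.
Qed.

End OrthogonalMatrices.

(** * Separation from a finite convex hull *)

Section FiniteConvexHull.
Variable R : realType.

Definition dot m (x y : 'rV[R]_m) : R := (x *m y^T) 0 0.

Lemma dotE m (x y : 'rV[R]_m) : dot x y = \sum_l x 0 l * y 0 l.
Proof. by rewrite /dot mxE; apply: eq_bigr => l _; rewrite mxE. Qed.

Lemma dotC m (x y : 'rV[R]_m) : dot x y = dot y x.
Proof. by rewrite !dotE; apply: eq_bigr => l _; rewrite mulrC. Qed.

Lemma dotDr m (x y z : 'rV[R]_m) : dot x (y + z) = dot x y + dot x z.
Proof. by rewrite /dot linearD mulmxDr mxE. Qed.

Lemma dotZr m c (x y : 'rV[R]_m) : dot x (c *: y) = c * dot x y.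
Proof. by rewrite /dot linearZ -scalemxAr mxE. Qed.

Lemma dotDl m (x y z : 'rV[R]_m) : dot (y + z) x = dot y x + dot z x.
Proof. by rewrite dotC dotDr !(dotC x). Qed.

Lemma dotZl m c (x y : 'rV[R]_m) : dot (c *: y) x = c * dot y x.
Proof. by rewrite dotC dotZr dotC. Qed.

Lemma dot_ge0 m (x : 'rV[R]_m) : 0 <= dot x x.
Proof. by rewrite dotE sumr_ge0 // => l _; rewrite -expr2 sqr_ge0. Qed.

Lemma dot_gt0 m (x : 'rV[R]_m) : x != 0 -> 0 < dot x x.
Proof.
move=> x0; rewrite lt_neqAle dot_ge0 andbT; apply: contraNneq x0 => /esym/eqP.
rewrite dotE psumr_eq0 => [/allP xx|l _]; last by rewrite -expr2 sqr_ge0.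
apply/eqP/rowP => l; rewrite mxE; apply/eqP.
by have := xx l (mem_index_enum l); rewrite /= mulf_eq0 orbb.
Qed.

Lemma conv_lmodE (V : lmodType R) (t : {i01 R}) (x y : convex_lmodType V) :
  conv t x y = (t%:num *: (x : V) + (1 - t%:num) *: (y : V) : V).
Proof. by []. Qed.

Lemma convex_halfspace m (x : 'rV[R]_m) (c : R) :
  convex_set [set y : convex_lmodType 'rV[R]_m | dot x y <= c].
Proof.
move=> y z t /set_mem/= yc /set_mem/= zc; apply/mem_set => /=.
rewrite conv_lmodE dotDr !dotZr.
have t0 : 0 <= t%:num by [].
have t1 : 0 <= 1 - t%:num by rewrite subr_ge0.
have := ler_wpM2l t0 yc; have := ler_wpM2l t1 zc; lra.
Qed.

(** By induction: the first point is joined to the renormalized combination of the others. If these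
    have total weight 0, renormalizing is impossible, but the sum is the first point. *)
Lemma convex_set_sum m (A : set 'rV[R]_m) : @convex_set R 'rV[R]_m A ->
  forall n (c : 'I_n -> R) (p : 'I_n -> 'rV[R]_m), (forall i, 0 <= c i) ->
    \sum_i c i = 1 -> (forall i, A (p i)) -> A (\sum_i c i *: p i).
Proof.
move=> cA; elim=> [|n IH] c p c0 c1 Ap.
  by move: c1; rewrite big_ord0 => /esym/eqP; rewrite oner_eq0.
rewrite big_ord_recl; move: c1; rewrite big_ord_recl => c1.
have S0 : 0 <= \sum_i c (lift ord0 i) by apply: sumr_ge0.
have [S1|S1] := eqVneq (\sum_i c (lift ord0 i)) 0.
  move: c1; rewrite S1 addr0 => ->; rewrite scale1r big1 ?addr0 // => i _.
  move/eqP: S1; rewrite psumr_eq0 // => /allP/(_ i (mem_index_enum i))/eqP ->.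
  by rewrite scale0r.
have c01 : 0 <= c ord0 <= 1 by rewrite c0 -c1 lerDl.
have oc : 1 - c ord0 = \sum_i c (lift ord0 i) by rewrite -c1 addrAC subrr add0r.
have := cA (p ord0) (\sum_i (c (lift ord0 i) / (1 - c ord0)) *: p (lift ord0 i))
  (Itv01 (proj1 (andP c01)) (proj2 (andP c01))).
move=> /(_ (mem_set (Ap _))); set y := \sum_i _.
have Ay : A y.
  apply: IH => // [i|]; first by rewrite mulr_ge0 // invr_ge0 oc.
  by rewrite -mulr_suml oc divff.
move=> /(_ (mem_set Ay))/set_mem; rewrite conv_lmodE; congr A; congr (_ + _).
rewrite scaler_sumr; apply: eq_bigr => i _.
by rewrite scalerA mulrCA oc divff // mulr1.
Qed.

Lemma simplex_compact n :
  compact [set c : 'rV[R]_n | (forall i, 0 <= c 0 i) /\ \sum_i c 0 i = 1].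
Proof.
apply: compact_mx_le1 => [|c [c0 c1] i j]; last first.
  rewrite ord1 ger0_norm // -c1 (bigD1 j) //= lerDl.
  by apply: sumr_ge0.
rewrite (_ : [set c | _] = (\bigcap_(i in [set: 'I_n])
    (fun c : 'rV[R]_n => c 0 i) @^-1` [set x | 0 <= x]) `&`
    (fun c : 'rV[R]_n => \sum_i c 0 i) @^-1` [set 1]); last first.
  by apply/seteqP; split => c /= [c0 c1]; split => // i; [move=> _|]; exact: c0.
apply: closedI; first apply: closed_bigI => i _.
  apply: preimage_closed; last exact: closed_ge.
  by move=> c _; exact: coord_continuous.
apply: preimage_closed; last exact: closed_eq.
move=> c _; apply: (@cvg_big _ _ _ _ _ _ _ (nbhs c)) => [|i _].
  exact: add_continuous.
exact: coord_continuous.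
Qed.

(* The separating functional is [o - y] for [y] the point of the hull nearest to
   [o]. *)
Lemma finite_hull_separation m (A : set 'rV[R]_m) (o : 'rV[R]_m) :
  finite_set A -> A !=set0 -> ~ convex_hull A o ->
  exists2 x : 'rV[R]_m, 0 < dot x x &
    forall p, A p -> dot x p <= dot x o - dot x x.
Proof.
move=> /finite_seqP[t ->] [p0 /= p0t] oA; pose n := size t.
(* The points are the rows of [P], so [c *m P] runs through convex combinations of them as [c] runs
   through the simplex [S], and [f] is the squared distance to [o]. *)
pose P : 'M[R]_(n, m) := \matrix_(i < n) nth 0 t i.
pose S := [set c : 'rV[R]_n | (forall i, 0 <= c 0 i) /\ \sum_i c 0 i = 1].
have SD (i : 'I_n) : S (delta_mx 0 i).
  split=> [j|]; first by rewrite mxE ler0n.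
  rewrite (bigD1 i) //= big1 ?addr0 => [|j ji]; first by rewrite mxE !eqxx.
  by rewrite mxE (negbTE ji) andbF.
have S0 : S !=set0.
  have it : (index p0 t < n)%N by rewrite index_mem.
  by exists (delta_mx 0 (Ordinal it)); exact: SD.
pose f (c : 'rV[R]_n) := dot (o - c *m P) (o - c *m P).
have cf : continuous f.
  have cx : continuous (fun c : 'rV[R]_n => o - c *m P).
    move=> c; apply: (@cvgB _ _ _ (nbhs c)); first exact: cvg_cst.
    have cP : continuous (fun c : 'rV[R]_n => c *m P).
      by apply: mulmx_continuous_comp => c'; [exact: cvg_id|exact: cst_continuous].
    exact: cP.
  have cxT : continuous (fun c : 'rV[R]_n => (o - c *m P)^T).
    by move=> c; exact: (continuous_comp (cx c) (@trmx_continuous _ _ _ _)).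
  have cxx : continuous (fun c : 'rV[R]_n => (o - c *m P) *m (o - c *m P)^T).
    exact: mulmx_continuous_comp.
  by move=> c; exact: (continuous_comp (cxx c) (@coord_continuous _ _ _ 0 0 _)).
have [c /set_mem[c0 c1] minc] := compact_EVT_min S0 (@simplex_compact n)
  (continuous_subspaceT cf).
have [x xE] : exists x, x = o - c *m P by exists (o - c *m P).
have x0 : x != 0.
  rewrite xE subr_eq0; apply: contra_notN oA => /eqP -> B [cB tB].
  rewrite mulmx_sum_row; apply: (convex_set_sum cB) => // i.
  by apply: tB; rewrite rowK /= mem_nth.
exists x; first exact: dot_gt0.
move=> p /= pt; have it : (index p t < n)%N by rewrite index_mem.
pose i := Ordinal it.
have pE : delta_mx 0 i *m P = p by rewrite -rowE rowK /= nth_index.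
have [y yE] : exists y, y = p - c *m P by exists (p - c *m P).
(* Moving from the nearest point a fraction [e] of the way towards [p] cannot decrease the distance
   to [o]. *)
have H (e : R) : 0 < e -> e <= 1 -> 2 * dot x y <= e * dot y y.
  move=> e0 e1.
  have Se : S (c + e *: (delta_mx 0 i - c)).
    have [D0 D1] := SD i; split=> [j|].
      rewrite !mxE; have := c0 j; have := D0 j; rewrite !mxE; nra.
    transitivity (\sum_j (c 0 j + e * ((delta_mx 0 i : 'rV[R]_n) 0 j - c 0 j))).
      by apply: eq_bigr => j _; rewrite !mxE.
    by rewrite big_split -mulr_sumr big_split /= sumrN c1 D1 subrr mulr0 addr0.
  have := minc _ (mem_set Se); rewrite /f.
  have -> : o - (c + e *: (delta_mx 0 i - c)) *m P = x + (- e) *: y.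
    rewrite mulmxDl -scalemxAl mulmxBl pE opprD addrA -xE -yE.
    by rewrite scaleNr.
  rewrite -xE !dotDr !dotDl !dotZr !dotZl (dotC y x) => H.
  rewrite -(ler_pM2l e0); nra.
have xy0 : dot x y <= 0.
  rewrite leNgt; apply/negP => xy.
  have yy := dot_ge0 y.
  have s0 : 0 < dot x y + dot y y by rewrite ltr_pwDl.
  (* If [dot x y] were positive, this fraction would lie in (0, 1] and give 2 (x.y + y.y) <= y.y,
     which is absurd. *)
  have := H (dot x y / (dot x y + dot y y)).
  rewrite divr_gt0 // ler_pdivrMr // mul1r lerDl => /(_ isT yy).
  rewrite mulrAC ler_pdivlMr //; nra.
have oE : o = x + c *m P by rewrite xE subrK.
have pE' : p = y + c *m P by rewrite yE subrK.
rewrite [in leRHS]oE {1}pE' !dotDr; lra.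
Qed.

End FiniteConvexHull.

(** * The matrix exponential in an orthonormal eigenbasis *)

Section MatrixExponential.
Variables (R : realType) (n : nat).

Lemma mulmx_col (A B : 'M[R]_n) i : A *m col i B = col i (A *m B).
Proof. by rewrite !colE mulmxA. Qed.

(** In the eigenbasis [B] each partial sum of the series is diagonal, with partial sums of the
    scalar exponential series on the diagonal; the limit is taken there. *)
Lemma expmx_eigen (D : 'M[R]_n) (u : 'I_n -> 'cV[R]_n) (lam : 'I_n -> R) :
  orthonormal_basis u -> (forall i, D *m u i = lam i *: u i) ->
  forall i, expmx D *m u i = expR (lam i) *: u i.
Proof.
move=> /orthonormal_basisP oB Du; set B := basis_mx u in oB.
have Bu i : u i = col i B by apply/colP => l; rewrite !mxE.
have Dm m i : D ^+ m *m u i = lam i ^+ m *: u i.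
  elim: m => [|m IH]; first by rewrite expr0 mul1mx expr0 scale1r.
  by rewrite exprSr -mulmxA Du -scalemxAr IH scalerA -exprS.
pose S N := series (fun m : nat => (m`!%:R)^-1 *: D ^+ m) N.
have SE N : S N = B *m diag_mx (\row_i series (exp_coeff (lam i)) N) *m B^T.
  have SB : S N *m B = B *m diag_mx (\row_i series (exp_coeff (lam i)) N).
    apply/matrixP => l i.
    have -> : (S N *m B) l i = (S N *m u i) l 0.
      by rewrite Bu mulmx_col [RHS]mxE.
    rewrite /S /series /= mulmx_suml
      (eq_bigr (fun m : nat => exp_coeff (lam i) m *: u i)).
      rewrite -scaler_suml mul_mx_diag !mxE mulrC.
      by rewrite /series /=.
    move=> m _; rewrite -scalemxAl Dm scalerA; congr (_ *: _).
    by rewrite mulrC.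
  by rewrite -SB -mulmxA (mulmx1C oB) mulmx1.
pose L := B *m diag_mx (\row_i expR (lam i)) *m B^T.
have SL : S @ \oo --> L.
  have cdiag : (fun N => diag_mx (\row_i series (exp_coeff (lam i)) N)) @ \oo -->
      diag_mx (\row_i expR (lam i)).
    apply: cvg_mx => i j; rewrite !mxE.
    under eq_cvg do rewrite !mxE.
    case: (i == j); rewrite ?mulr1n ?mulr0n; last exact: cvg_cst.
    exact: is_cvg_series_exp_coeff.
  have -> : S = fun N => B *m diag_mx (\row_i series (exp_coeff (lam i)) N) *m B^T.
    by apply/funext => N; exact: SE.
  have cM : continuous (fun W : 'M[R]_n => B *m W *m B^T).
    apply: mulmx_continuous_comp => W; last exact: cst_continuous.
    apply: mulmx_continuous_comp => W'; first exact: cst_continuous.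
    exact: cvg_id.
  exact: (cvg_comp _ _ cdiag (cM _)).
have -> : expmx D = L by exact: (cvg_lim (@norm_hausdorff _ _) SL).
move=> i; rewrite Bu /L mulmx_col -mulmxA oB mulmx1.
by apply/colP => l; rewrite mxE mul_mx_diag !mxE mulrC.
Qed.

Lemma diagonal_in_basis (u : 'I_n -> 'cV[R]_n) (lam : 'I_n -> R) :
  orthonormal_basis u -> exists D : 'M[R]_n,
    [/\ symmetric_mx D, forall i, D *m u i = lam i *: u i & \tr D = \sum_i lam i].
Proof.
move=> /orthonormal_basisP oB; set B := basis_mx u in oB.
have Bu i : u i = col i B by apply/colP => l; rewrite !mxE.
exists (B *m diag_mx (\row_i lam i) *m B^T); split=> [|i|].
- by rewrite /symmetric_mx !trmx_mul trmxK tr_diag_mx mulmxA.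
- rewrite Bu mulmx_col -mulmxA oB mulmx1.
  by apply/colP => l; rewrite mxE mul_mx_diag !mxE mulrC.
rewrite mxtrace_mulC mulmxA oB mul1mx mxtrace_diag.
by apply: eq_bigr => i _; rewrite mxE.
Qed.

End MatrixExponential.

(** * Exponents and the Newton polytope *)

Section NewtonPolytope.
Variables (R : realType) (d1 k d : nat).
Implicit Types (a : 'rV[R]_d1) (b : 'rV[R]_k) (g : 'rV[R]_d).
Implicit Types Q : triform R d1 k d.

Definition count_index n s (i : 'I_s -> 'I_n) (l : 'I_n) : nat :=
  #|[pred r | i r == l]|.

Lemma sum_count_index n s (i : 'I_s -> 'I_n) (f : 'I_n -> R) :
  \sum_r f (i r) = \sum_l f l * (count_index i l)%:R.
Proof.
rewrite (partition_big i xpredT) //=; apply: eq_bigr => l _.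
rewrite mulr_natr -sumr_const; apply: eq_big => [r|r /eqP->] //.
Qed.

Lemma card_count_index n s (i : 'I_s -> 'I_n) : (\sum_l count_index i l = s)%N.
Proof.
rewrite -[RHS]card_ord -sum1_card (partition_big i xpredT) //=.
by apply: eq_bigr => l _; rewrite /count_index -sum1_card; apply: eq_bigl.
Qed.

Definition index_point s (i : 'I_s -> 'I_d1) (i' : 'I_s -> 'I_k)
    (i'' : 'I_s -> 'I_d) : 'rV[R]_(d1 + k + d) :=
  multiindex_point R (count_index i) (count_index i') (count_index i'').

Lemma dot_triple_point a b g (x : 'rV[R]_d1) (y : 'rV[R]_k) (z : 'rV[R]_d) :
  dot (triple_point a b g) (triple_point x y z) = dot a x + dot b y + dot g z.
Proof. by rewrite /dot /triple_point !tr_row_mx !mul_row_col !mxE. Qed.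

(** The right side is the factor that [form_detZ] extracts when the basis vectors are scaled by
    exponentials. *)
Lemma expR_dot_index_point a b g s (i : 'I_s -> 'I_d1) (i' : 'I_s -> 'I_k)
    (i'' : 'I_s -> 'I_d) :
  expR (dot (triple_point a b g) (index_point i i' i'')) =
  (\prod_r expR (a 0 (i r))) * (\prod_r expR (b 0 (i' r)))
    * (\prod_r expR (g 0 (i'' r))).
Proof.
rewrite dot_triple_point !expRD -!expR_sum.
rewrite !(sum_count_index _ (fun l => _ 0 l)) !dotE.
by congr (expR _ * expR _ * expR _); apply: eq_bigr => l _; rewrite !mxE.
Qed.

Lemma dot_o_pt a b g s :
  dot (triple_point a b g) (o_pt d1 k d s) =
  (\sum_l a 0 l) * (s / d1%:R) + (\sum_l b 0 l) * (s / k%:R)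
    + (\sum_l g 0 l) * (s / d%:R).
Proof.
rewrite dot_triple_point !dotE !mulr_suml.
by congr (_ + _ + _); apply: eq_bigr => l _; rewrite mxE.
Qed.

(** Working form of [N0]: the multiindices are recovered from the sequences by counting, and the
    case [s] = 0 contributes exactly the origin. *)
Lemma N0P Q u v w p : trilinear Q ->
  N0 Q u v w p <-> p = 0 \/
  exists s (i : 'I_s -> 'I_d1) (i' : 'I_s -> 'I_k) (i'' : 'I_s -> 'I_d),
    [/\ (0 < s <= minn d k)%N, p = index_point i i' i'' &
        form_det (fun x y z => Q (u x) (v y) (w z)) i i' i'' != 0].
Proof.
move=> triQ; have eq0 n (al : 'I_n -> nat) :
    (\sum_l al l = 0)%N -> \row_l (al l)%:R = 0 :> 'rV[R]_n.
  move=> /eqP; rewrite sum_nat_eq0 => /forallP al0.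
  by apply/rowP => l; rewrite !mxE (eqP (al0 l)).
split=> [[s [al [be [ga [[sa sb sg] [sdk -> H]]]]]]|[->|]].
- case: (posnP s) sa sb sg => [-> /eq0 a0 /eq0 b0 /eq0 g0|s0 _ _ _].
    by left; rewrite /multiindex_point a0 b0 g0 /triple_point !row_mx0.
  right; case: H => [s00|[i [i' [i'' [ci ci' ci'' /eqP]]]]].
    by rewrite s00 in s0.
  rewrite derive_QdetE // => T0; exists s, i, i', i''; split=> //.
    by rewrite s0.
  by congr multiindex_point; apply/funext => l; rewrite -?ci -?ci' -?ci''.
- exists 0%N, (fun=> 0%N), (fun=> 0%N), (fun=> 0%N); rewrite !big1 //.
  split=> //; split=> //; last by left.
  by rewrite /multiindex_point /triple_point !eq0 ?big1 // !row_mx0.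
case=> s [i [i' [i'' [/andP[s0 sdk] -> T0]]]].
exists s, (count_index i), (count_index i'), (count_index i'').
split; first by rewrite !card_count_index.
split=> //; right; exists i, i', i''; split=> //.
by rewrite derive_QdetE //; exact/eqP.
Qed.

(** All coordinates are naturals bounded by the total [s], hence by [minn d k]. *)
Lemma N0_finite Q u v w : finite_set (N0 Q u v w).
Proof.
pose m := minn d k.
pose P (j : {ffun 'I_d1 -> 'I_m.+1} * {ffun 'I_k -> 'I_m.+1}
            * {ffun 'I_d -> 'I_m.+1}) : 'rV[R]_(d1 + k + d) :=
  multiindex_point R (fun l => j.1.1 l) (fun l => j.1.2 l) (fun l => j.2 l).
apply: (@sub_finite_set _ _ [set P j | j in setT]); last first.
  by apply: finite_image; exact: finite_finset.
move=> p [s [al [be [ga [[sa sb sg] [sm -> _]]]]]].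
have bd n (c : 'I_n -> nat) : (\sum_l c l = s)%N ->
    (fun l => nat_of_ord ([ffun l' => inord (c l') : 'I_m.+1] l)) = c.
  move=> cs; apply/funext => l; rewrite ffunE inordK // ltnS.
  by apply: leq_trans sm; rewrite -cs (bigD1 l) //= leq_addr.
exists ([ffun l => inord (al l)], [ffun l => inord (be l)],
  [ffun l => inord (ga l)]) => //.
by rewrite /P /= !bd.
Qed.

Lemma basis_det_expR n (O : 'M[R]_n) (a : 'rV[R]_n) : orthogonal_mx O ->
  `|basis_det (fun i => expR (a 0 i) *: col i O)| = expR (\sum_i a 0 i).
Proof.
move=> oO; rewrite basis_det_scale normrM det_orthogonal_mx // mul1r expR_sum.
by rewrite ger0_norm // prodr_ge0 // => i _; exact: expR_ge0.
Qed.

Lemma expR_powR (r t : R) : expR r `^ t = expR (r * t).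
Proof. by rewrite /powR expR_eq0 expRK mulrC. Qed.

Lemma det_weight_expR (O1 : 'M[R]_d1) (O2 : 'M[R]_k) (O3 : 'M[R]_d) a b g s :
  orthogonal_mx O1 -> orthogonal_mx O2 -> orthogonal_mx O3 ->
  det_weight s (fun i => expR (a 0 i) *: col i O1)
    (fun i => expR (b 0 i) *: col i O2) (fun i => expR (g 0 i) *: col i O3) =
  expR (dot (triple_point a b g) (o_pt d1 k d s)).
Proof.
move=> o1 o2 o3; rewrite dot_o_pt !expRD -!expR_powR.
by rewrite /det_weight !basis_det_expR.
Qed.

Lemma form_det_expR Q u v w a b g s (i : 'I_s -> 'I_d1) (i' : 'I_s -> 'I_k)
    (i'' : 'I_s -> 'I_d) : trilinear Q ->
  form_det (fun x y z => Q (expR (a 0 x) *: u x) (expR (b 0 y) *: v y)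
    (expR (g 0 z) *: w z)) i i' i'' =
  expR (dot (triple_point a b g) (index_point i i' i'')) *
  form_det (fun x y z => Q (u x) (v y) (w z)) i i' i''.
Proof.
move=> [Q1 Q2 Q3]; rewrite expR_dot_index_point.
rewrite -(form_detZ _ (fun x => expR (a 0 x)) (fun y => expR (b 0 y))
  (fun z => expR (g 0 z))).
congr (form_det _ i i' i''); apply/funext => x; apply/funext => y; apply/funext => z.
rewrite (scalar_funZ _ _ (Q1 _ _)) (scalar_funZ _ _ (Q2 _ _)).
by rewrite (scalar_funZ _ _ (Q3 _ _)) !mulrA.
Qed.

(** Each nonzero coefficient grows by a factor of at most [expR t]. The summand 1 of [calQ] is
    covered as well, since the origin lies in [N0] and forces [t] to be nonnegative. *)
Lemma calQ_expR_le Q u v w a b g (t : R) : trilinear Q ->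
  (forall p, N0 Q u v w p -> dot (triple_point a b g) p <= t) ->
  calQ Q (fun i => expR (a 0 i) *: u i) (fun i => expR (b 0 i) *: v i)
    (fun i => expR (g 0 i) *: w i) <= expR t * calQ Q u v w.
Proof.
move=> triQ N0t; have t0 : 0 <= t.
  have /N0t : N0 Q u v w 0 by apply/(N0P _ _ _ _ triQ); left.
  by rewrite /dot trmx0 mulmx0 mxE.
have e1 : 1 <= expR t ^+ 2 by rewrite exprn_ege1 // -expR0 ler_expR.
rewrite !calQE // -[X in X * _]gtr0_norm ?expR_gt0 // -sqrtr_sqr.
rewrite -sqrtrM ?sqr_ge0 //.
rewrite ler_wsqrtr // mulrDr mulr1 lerD // /sum_sqr.
rewrite mulr_sumr !big_nat; apply: ler_sum => s /andP[s0 sdk].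
do 3!(rewrite mulr_sumr; apply: ler_sum => ? _).
rewrite form_det_expR // exprMn.
set T := form_det _ _ _ _; have [->|T0] := eqVneq T 0.
  by rewrite expr0n mulr0 mulr0.
rewrite ler_wpM2r ?sqr_ge0 // ler_pXn2r ?nnegrE ?expR_ge0 // ler_expR.
apply: N0t; apply/(N0P _ _ _ _ triQ); right.
do 4!eexists; split; [apply/andP; split; [exact: s0|exact: sdk]| |exact: T0].
by [].
Qed.

(* [N0 Q u v w] lies in the half-space [dot (a, b, g) <= ln (calQ Q' / e)], hence
   so does its convex hull. *)
Lemma calQ_expR_ge Q Q' u v w u' v' w' a b g (e : R) p :
  trilinear Q -> trilinear Q' -> 0 < e -> e <= 1 ->
  (forall s (i : 'I_s -> 'I_d1) (i' : 'I_s -> 'I_k) (i'' : 'I_s -> 'I_d),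
    (0 < s <= minn d k)%N ->
    form_det (fun x y z => Q (u x) (v y) (w z)) i i' i'' != 0 ->
    e <= `|form_det (fun x y z => Q' (u' x) (v' y) (w' z)) i i' i''|) ->
  convex_hull (N0 Q u v w) p ->
  e * expR (dot (triple_point a b g) p) <=
  calQ Q' (fun i => expR (a 0 i) *: u' i) (fun i => expR (b 0 i) *: v' i)
    (fun i => expR (g 0 i) *: w' i).
Proof.
move=> triQ triQ' e0 e1 eT hp; set C := calQ _ _ _ _.
have C1 : 1 <= C by exact: calQ_ge1.
have C0 : 0 < C by exact: lt_le_trans C1.
have leC x : (e * expR x <= C) = (x <= ln (C / e)).
  rewrite -[RHS]ler_expR lnK ?posrE ?divr_gt0 // ler_pdivlMr //.
  by rewrite mulrC.
rewrite leC; apply: (hp [set y | dot (triple_point a b g) y <= ln (C / e)]).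
split; first exact: convex_halfspace.
(* At the origin the bound is [e] <= 1 <= [C]; at any other point a single coefficient already
   bounds [C] from below. *)
move=> q /(N0P _ _ _ _ triQ)[->|[s [i [i' [i'' [sdk -> T0]]]]]] /=; rewrite -leC.
  by rewrite /dot trmx0 mulmx0 mxE expR0 mulr1 (le_trans e1).
have := form_det_le_calQ triQ' i i' i'' (fun i => expR (a 0 i) *: u' i)
  (fun i => expR (b 0 i) *: v' i) (fun i => expR (g 0 i) *: w' i) sdk.
apply: le_trans; rewrite form_det_expR // normrM ger0_norm ?expR_ge0 //.
by rewrite mulrC ler_wpM2l ?expR_ge0 // eT.
Qed.

End NewtonPolytope.

(** * The two alternatives *)

Section Dichotomy.
Variables (R : realType) (d1 k d : nat).
Hypotheses (hd1 : (0 < d1)%N) (hk : (0 < k)%N) (hd : (0 < d)%N).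
Variable Q : triform R d1 k d.
Hypothesis triQ : trilinear Q.

(** Nearness of forms as a filter, for use in products with neighbourhoods of matrices. It tests
    trilinear forms only, so trilinearity holds eventually. *)
Definition form_nbhs : set_system (triform R d1 k d) := near_form Q.

Lemma form_nbhs_filter : Filter form_nbhs.
Proof.
split=> [|A B [e e0 eA] [e' e'0 eB]|A B AB [e e0 eA]].
- by exists 1.
- exists (Num.min e e') => [|Q' triQ' QQ']; first by rewrite lt_min e0.
  by split; [apply: eA|apply: eB] => // i j l; move: (QQ' i j l);
    rewrite lt_min => /andP[].
by exists e => // Q' triQ' QQ'; apply: AB; exact: eA.
Qed.
#[local] Existing Instance form_nbhs_filter.

Lemma form_nbhs_trilinear : form_nbhs (@trilinear R d1 k d).
Proof. by exists 1. Qed.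

Lemma cvg_form_nbhs i j l :
  Q' (delta_mx i 0) (delta_mx j 0) (delta_mx l 0) @[Q' --> form_nbhs] -->
  Q (delta_mx i 0) (delta_mx j 0) (delta_mx l 0).
Proof.
apply/cvgrPdist_lt => e e0; exists e => // Q' _ /(_ i j l).
by rewrite distrC.
Qed.

Lemma trilinear_coord (Q' : triform R d1 k d) t v w : trilinear Q' ->
  Q' t v w = \sum_i \sum_j \sum_l t i 0 * (v j 0 * (w l 0 *
    Q' (delta_mx i 0) (delta_mx j 0) (delta_mx l 0))).
Proof.
have colE n (x : 'cV[R]_n) : x = \sum_i x i 0 *: delta_mx i 0.
  rewrite {1}[x]matrix_sum_delta; apply: eq_bigr => i _.
  by rewrite big_ord1.
move=> [Q1 Q2 Q3]; rewrite {1}(colE _ t) {1}(colE _ v) {1}(colE _ w).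
rewrite (scalar_fun_sum _ _ (Q1 _ _)); apply: eq_bigr => i _.
rewrite (scalar_fun_sum _ _ (Q2 _ _)) mulr_sumr; apply: eq_bigr => j _.
rewrite (scalar_fun_sum _ _ (Q3 _ _)) !mulr_sumr; apply: eq_bigr => l _.
by [].
Qed.

Let mxs : topologicalType := ('M[R]_d1 * 'M[R]_k * 'M[R]_d)%type.

Lemma cvg_trilinear_col (X : mxs) x y z :
  p.2 (col x p.1.1.1) (col y p.1.1.2) (col z p.1.2)
    @[p --> filter_prod (nbhs X) form_nbhs] -->
  Q (col x X.1.1) (col y X.1.2) (col z X.2).
Proof.
set F := filter_prod _ _.
have FF : Filter F by exact: filter_prod_filter.
rewrite (trilinear_coord _ _ _ triQ).
(* The expansion in coordinates is valid for trilinear forms, that is, eventually along [F]; there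
   it is a polynomial in entries and coefficients. *)
apply: (@cvg_trans _ ((fun p : mxs * triform R d1 k d =>
  \sum_i \sum_j \sum_l col x p.1.1.1 i 0 * (col y p.1.1.2 j 0 *
   (col z p.1.2 l 0 * p.2 (delta_mx i 0) (delta_mx j 0) (delta_mx l 0)))) @ F)).
  apply: near_eq_cvg.
  have : F [set p | trilinear p.2].
    by exists (setT, @trilinear R d1 k d) => [|p []//]; split;
      [exact: filterT|exact: form_nbhs_trilinear].
  by apply: filterS => p triP; rewrite [RHS](trilinear_coord _ _ _ triP).
have cX : p.1 @[p --> F] --> X by exact: cvg_fst.
have cX12 : p.1.1 @[p --> F] --> X.1 by exact: (cvg_comp _ _ cX cvg_fst).
have cX1 : p.1.1.1 @[p --> F] --> X.1.1 by exact: (cvg_comp _ _ cX12 cvg_fst).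
have cX2 : p.1.1.2 @[p --> F] --> X.1.2 by exact: (cvg_comp _ _ cX12 cvg_snd).
have cX3 : p.1.2 @[p --> F] --> X.2 by exact: (cvg_comp _ _ cX cvg_snd).
have c_col n (f : mxs * triform R d1 k d -> 'M[R]_n) (M : 'M[R]_n) j i :
    f @ F --> M -> col j (f p) i 0 @[p --> F] --> col j M i 0.
  move=> fM; rewrite mxE; under eq_fun do rewrite mxE.
  exact: (@cvg_comp _ _ _ f (fun N => N i j) _ _ _ fM (@coord_continuous _ _ _ i j M)).
apply: cvg_big => [|i _]; first exact: add_continuous.
apply: cvg_big => [|j _]; first exact: add_continuous.
apply: cvg_big => [|l _]; first exact: add_continuous.
apply: cvgM; first exact: c_col.
apply: cvgM; first exact: c_col.
apply: cvgM; first exact: c_col.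
have cQ : snd @ F --> form_nbhs by exact: cvg_snd.
exact: (@cvg_comp _ _ _ snd (fun Q' : triform R d1 k d =>
  Q' (delta_mx i 0) (delta_mx j 0) (delta_mx l 0)) _ _ _ cQ (@cvg_form_nbhs i j l)).
Qed.

Definition orthogonal_triples : set mxs :=
  (@orthogonal_mx R d1 `*` @orthogonal_mx R k) `*` @orthogonal_mx R d.

Lemma orthogonal_triples_compact : compact orthogonal_triples.
Proof.
by apply: compact_setX; [apply: compact_setX|]; exact: orthogonal_mx_compact.
Qed.

(** The bound holds near each orthogonal triple, for nearby forms and small [e]; near-covering
    compactness makes it uniform over all triples. *)
Lemma NR_calQ_orthogonal p : NR Q p ->
  exists2 e, 0 < e & near_form Q (fun Q' => trilinear Q' /\
    forall O1 O2 O3, orthogonal_mx O1 -> orthogonal_mx O2 -> orthogonal_mx O3 ->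
    forall (a : 'rV[R]_d1) (b : 'rV[R]_k) (g : 'rV[R]_d),
    e * expR (dot (triple_point a b g) p) <=
    calQ Q' (fun i => expR (a 0 i) *: col i O1) (fun i => expR (b 0 i) *: col i O2)
      (fun i => expR (g 0 i) *: col i O3)).
Proof.
move=> Qp.
pose B (Qe : triform R d1 k d * R) (X : mxs) :=
  forall (a : 'rV[R]_d1) (b : 'rV[R]_k) (g : 'rV[R]_d),
    Qe.2 * expR (dot (triple_point a b g) p) <=
    calQ Qe.1 (fun i => expR (a 0 i) *: col i X.1.1)
      (fun i => expR (b 0 i) *: col i X.1.2) (fun i => expR (g 0 i) *: col i X.2).
(* The constant [e], tending to 0 from above, is a parameter of the filter, so that the covering
   argument yields one constant for all triples. *)
pose F : set_system (triform R d1 k d * R) := filter_prod form_nbhs (0 : R)^'+.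
have FF : Filter F by exact: filter_prod_filter.
have /compact_near_coveringP/(_ _ F B FF) := orthogonal_triples_compact.
case=> [X [[/= o1 o2] o3]|[/= A E] [/= nA nE] AEB]; last first.
  have [e [Ee e0]] : exists e, (E `&` [set x | 0 < x]) e.
    exact: (filter_ex (filterI nE (nbhs_right_gt (0 : R)))).
  exists e => //.
  have : form_nbhs (@trilinear R d1 k d `&` A).
    by apply: filterI => //; exact: form_nbhs_trilinear.
  apply: filterS => Q' [triQ' AQ']; split=> // O1 O2 O3 o1 o2 o3.
  by apply: (AEB (Q', e) _ (O1, O2, O3)).
(* The hull is used at the centre [X] and for [Q] itself; nearby triples and forms enter only
   through the coefficients that are nonzero at [X]. *)
have hX : convex_hull (N0 Q (fun i => col i X.1.1) (fun i => col i X.1.2)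
    (fun i => col i X.2)) p.
  by apply: Qp; apply/orthonormal_basisP; rewrite basis_mx_col.
pose T (Q' : triform R d1 k d) (Y : mxs) s (i : 'I_s -> 'I_d1) (i' : 'I_s -> 'I_k)
    (i'' : 'I_s -> 'I_d) :=
  form_det (fun x y z => Q' (col x Y.1.1) (col y Y.1.2) (col z Y.2)) i i' i''.
pose G : set_system (mxs * (triform R d1 k d * R)) := filter_prod (nbhs X) F.
have FG : Filter G by exact: filter_prod_filter.
have nT s (i : 'I_s -> 'I_d1) (i' : 'I_s -> 'I_k) (i'' : 'I_s -> 'I_d) :
    G [set p | T Q X s i i' i'' != 0 -> p.2.2 <= `|T p.2.1 p.1 s i i' i''|].
  have [T0|T0] := eqVneq (T Q X s i i' i'') 0.
    by apply: filterS (filterT : G setT) => p' _ /=; rewrite ?T0 ?eqxx.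
  (* Half the value at [X] separates small constants [e] from the coefficients at nearby points. *)
  have T2 : 0 < `|T Q X s i i' i''| / 2 by rewrite divr_gt0 ?normr_gt0.
  have cT : T p.2 p.1 s i i' i'' @[p --> filter_prod (nbhs X) form_nbhs] -->
      T Q X s i i' i''.
    by apply: cvg_form_det => x y z; exact: cvg_trilinear_col.
  have /(cvgr_norm_gt _ cT) [[A E] /= [nA nE] AE] :
      `|T Q X s i i' i''| / 2 < `|T Q X s i i' i''|.
    by rewrite ltr_pdivrMr // ltr_pMr ?normr_gt0 // ltr1n.
  exists (A, E `*` [set e | e < `|T Q X s i i' i''| / 2]).
    split=> //=; exists (E, [set e | e < `|T Q X s i i' i''| / 2]) => //.
    by split=> //; exact: nbhs_right_lt.
  move=> [Y [Q' e]] /= [AY [EQ' eT]] _.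
  by apply/ltW/(lt_trans eT)/(AE (Y, Q')).
(* Bounded [s] and finite functions make this a finite intersection of eventual conditions. *)
have nT_all : G [set p | forall (s : 'I_(minn d k).+1)
    (i : {ffun 'I_s -> 'I_d1}) (i' : {ffun 'I_s -> 'I_k}) (i'' : {ffun 'I_s -> 'I_d}),
    T Q X s i i' i'' != 0 -> p.2.2 <= `|T p.2.1 p.1 s i i' i''|].
  exact: (filter_forall _ (fun s : 'I_(minn d k).+1 => filter_forall _
    (fun i : {ffun 'I_s -> 'I_d1} => filter_forall _ (fun i' : {ffun 'I_s -> 'I_k} =>
      filter_forall _ (fun i'' : {ffun 'I_s -> 'I_d} => nT s i i' i''))))).
have ntri : G [set p | trilinear p.2.1 /\ 0 < p.2.2 <= 1].
  exists (setT, @trilinear R d1 k d `*` [set e | 0 < e <= 1]) => [|[Y Qe] [_ []] //].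
  split; first exact: filterT.
  exists (@trilinear R d1 k d, [set e | 0 < e <= 1]) => //.
  split=> /=; first exact: form_nbhs_trilinear.
  by near=> e; apply/andP; split; near: e; [exact: nbhs_right_gt|exact: nbhs_right_le].
apply: (@filterS _ G _ _ _ _ (filterI nT_all ntri)).
move=> [Y [Q' e]] /= [eT [triQ' /andP[e0 e1]]] a b g.
apply: (calQ_expR_ge _ _ _ triQ triQ' e0 e1 _ hX) => s i i' i'' /andP[_ sdk] T0.
have sdk' : (s < (minn d k).+1)%N by [].
have ffE n (j : 'I_s -> 'I_n) : j = [ffun a => j a].
  by apply/funext => l; rewrite ffunE.
rewrite (ffE _ i) (ffE _ i') (ffE _ i'') in T0 *.
exact: (eT (Ordinal sdk')).
Unshelve. all: by end_near. Qed.

(** Singular values reduce arbitrary bases to scaled orthonormal ones, with logarithms of the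
    singular values as exponents. *)
Lemma NR_calQ s : NR Q (o_pt d1 k d s) -> exists2 c : R, 0 < c &
  near_form Q (fun Q' => forall u v w, is_basis u -> is_basis v -> is_basis w ->
    c * det_weight s u v w <= calQ Q' u v w).
Proof.
move=> /NR_calQ_orthogonal[e e0 He]; exists e => //.
apply: (@filterS _ form_nbhs _ _ _ _ He) => Q' [triQ' le_calQ] u v w.
move=> /singular_value_decomposition[V1 [P1 [a [oV1 oP1 a0 uV]]]].
move=> /singular_value_decomposition[V2 [P2 [b [oV2 oP2 b0 vV]]]].
move=> /singular_value_decomposition[V3 [P3 [g [oV3 oP3 g0 wV]]]].
rewrite -(calQ_mix triQ' u v w (orthogonal_mx_rows oV1) (orthogonal_mx_rows oV2)
  (orthogonal_mx_rows oV3)).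
have expln n (c : 'I_n -> R) (O : 'M[R]_n) : (forall i, 0 < c i) ->
    (fun i => c i *: col i O) =
    (fun i => expR ((\row_j ln (c j) : 'rV[R]_n) 0 i) *: col i O).
  by move=> c0; apply/funext => i; rewrite mxE lnK ?posrE.
have -> : det_weight s u v w = det_weight s (fun i => \sum_l V1 l i *: u l)
    (fun i => \sum_l V2 l i *: v l) (fun i => \sum_l V3 l i *: w l).
  by rewrite /det_weight !basis_det_mix.
rewrite (funext uV) (funext vV) (funext wV).
rewrite (expln _ a P1 a0) (expln _ b P2 b0) (expln _ g P3 g0).
by rewrite det_weight_expR // le_calQ.
Qed.

(** * Decaying families of bases *)

Lemma expmx_scale_eigen n (D : 'M[R]_n) (u : 'I_n -> 'cV[R]_n) (lam : 'rV[R]_n) t :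
  orthonormal_basis u -> (forall i, D *m u i = lam 0 i *: u i) ->
  (fun i => expmx (t *: D) *m u i) = (fun i => expR ((t *: lam) 0 i) *: u i).
Proof.
move=> ou Du; apply/funext => i; rewrite mxE.
apply: (@expmx_eigen _ _ _ _ (fun j => t * lam 0 j) ou) => j.
by rewrite -scalemxAl Du scalerA.
Qed.

Lemma diagonalizesP n (u : 'I_n -> 'cV[R]_n) (D : 'M[R]_n) : diagonalizes u D ->
  exists lam : 'rV[R]_n, forall i, D *m u i = lam 0 i *: u i.
Proof. by move=> /choice[lam Du]; exists (\row_i lam i) => i; rewrite mxE. Qed.

Lemma is_basis_expR n (u : 'I_n -> 'cV[R]_n) (a : 'rV[R]_n) :
  orthonormal_basis u -> is_basis (fun i => expR (a 0 i) *: u i).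
Proof.
move=> /orthonormal_basisP ou; apply/is_basisP.
by rewrite (col_basis_mx u) -normr_gt0 basis_det_expR // expR_gt0.
Qed.

Definition decaying_bases s : Prop :=
  exists (u : 'I_d1 -> 'cV[R]_d1) (v : 'I_k -> 'cV[R]_k)
         (w : 'I_d -> 'cV[R]_d)
         (D1 : 'M[R]_d1) (D2 : 'M[R]_k) (D3 : 'M[R]_d),
    [/\ orthonormal_basis u, orthonormal_basis v & orthonormal_basis w] /\
    [/\ symmetric_mx D1, symmetric_mx D2 & symmetric_mx D3] /\
    [/\ diagonalizes u D1, diagonalizes v D2 & diagonalizes w D3] /\
    [/\ 0 < \tr D1, \tr D2 = 0 & \tr D3 = 0] /\
    (let U (tau : R) := fun i => expmx (tau *: D1) *m u i in
     let V (tau : R) := fun i => expmx (tau *: D2) *m v i in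
     let W (tau : R) := fun i => expmx (tau *: D3) *m w i in
     calQ Q (U tau) (V tau) (W tau) / det_weight s (U tau) (V tau) (W tau)
       @[tau --> +oo] --> (0 : R)).

Lemma det_weight_gt0 s u v w : is_basis u -> is_basis v -> is_basis w ->
  0 < @det_weight R d1 k d s u v w.
Proof.
move=> /is_basisP u0 /is_basisP v0 /is_basisP w0.
by rewrite /det_weight !mulr_gt0 ?powR_gt0 ?normr_gt0.
Qed.

(** [Q] is near itself, so a bound would keep the ratio above [c] for every parameter, against its
    limit 0. *)
Lemma decaying_bases_not_bounded s : decaying_bases s ->
  ~ exists2 c : R, 0 < c &
  near_form Q (fun Q' => forall u v w, is_basis u -> is_basis v -> is_basis w ->
    c * det_weight s u v w <= calQ Q' u v w).
Proof.
move=> [u [v [w [D1 [D2 [D3 [[ou ov ow] [_ [[du dv dw] [_ /= lim0]]]]]]]]]].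
move=> [c c0 [e e0 /(_ Q triQ)]].
have QQ i j l : `|Q (delta_mx i 0) (delta_mx j 0) (delta_mx l 0) -
    Q (delta_mx i 0) (delta_mx j 0) (delta_mx l 0)| < e by rewrite subrr normr0.
move=> /(_ QQ) ge_c.
have [a ua] := diagonalizesP du.
have [b vb] := diagonalizesP dv.
have [g wg] := diagonalizesP dw.
have [t] := @filter_ex _ (+oo : set_system R) _ _ (cvgr_lt _ lim0 _ c0).
rewrite (expmx_scale_eigen _ ou ua) (expmx_scale_eigen _ ov vb).
rewrite (expmx_scale_eigen _ ow wg) ltNge => /negP; apply.
have := ge_c _ _ _ (is_basis_expR (t *: a) ou) (is_basis_expR (t *: b) ov)
  (is_basis_expR (t *: g) ow).
by rewrite ler_pdivlMr // det_weight_gt0 //; exact: is_basis_expR.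
Qed.

(* Adding constants of total 0 to the three blocks of a functional does not change
   it on points whose blocks have the same sum. *)
Lemma dot_shift (a : 'rV[R]_d1) (b : 'rV[R]_k) (g : 'rV[R]_d) (c c' t : R)
    (x : 'rV[R]_d1) (y : 'rV[R]_k) (z : 'rV[R]_d) :
  \sum_l x 0 l = t -> \sum_l y 0 l = t -> \sum_l z 0 l = t ->
  dot (triple_point (a + const_mx (c + c')) (b - const_mx c) (g - const_mx c'))
    (triple_point x y z) = dot (triple_point a b g) (triple_point x y z).
Proof.
have dotc n (x' : 'rV[R]_n) r : dot (const_mx r) x' = r * \sum_l x' 0 l.
  by rewrite dotE mulr_sumr; apply: eq_bigr => l _; rewrite mxE.
have dotN n (x' y' : 'rV[R]_n) : dot (- x') y' = - dot x' y'.
  by rewrite -scaleN1r dotZl mulN1r.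
move=> xt yt zt; rewrite !dot_triple_point !dotDl !dotN !dotc xt yt zt; ring.
Qed.

(** Write [xi] for the separating vector and [M] for its product with [o_pt]. On [N0] the product is
    at most M - |xi|^2, so [calQ] grows at most like e^(t (M - |xi|^2)), while the weight is e^(t
    M). *)
Lemma not_NR_decaying_bases s : 0 <= s -> ~ NR Q (o_pt d1 k d s) ->
  decaying_bases s.
Proof.
move=> s0 nNR.
have [u [v [w [ou ov ow nhull]]]] : exists u v w,
    [/\ orthonormal_basis u, orthonormal_basis v, orthonormal_basis w &
        ~ convex_hull (N0 Q u v w) (o_pt d1 k d s)].
  apply: contrapT => H; apply: nNR => u v w ou ov ow.
  by apply: contrapT => nh; apply: H; exists u, v, w.
have N00 : N0 Q u v w 0 by apply/(N0P _ _ _ _ triQ); left.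
have [xi xi0 xiP] := finite_hull_separation (N0_finite Q u v w)
  (ex_intro _ _ N00) nhull.
pose a0 := lsubmx (lsubmx xi); pose b0 := rsubmx (lsubmx xi); pose g0 := rsubmx xi.
have xiE : xi = triple_point a0 b0 g0 by rewrite /triple_point !hsubmxK.
(* These are the mean values of the second and third blocks: subtracting them gives zero traces, and
   the first block compensates. *)
pose c := (\sum_l b0 0 l) / k%:R; pose c' := (\sum_l g0 0 l) / d%:R.
pose a := a0 + const_mx (c + c'); pose b := b0 - const_mx c.
pose g := g0 - const_mx c'.
have natr0 n : (0 < n)%N -> n%:R != 0 :> R by rewrite pnatr_eq0 lt0n.
have sum_shift n (x : 'rV[R]_n) r :
    \sum_l (x + const_mx r) 0 l = \sum_l x 0 l + r * n%:R.
  have -> : r * n%:R = \sum_(l < n) r by rewrite sumr_const card_ord mulr_natr.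
  by rewrite -big_split; apply: eq_bigr => l _; rewrite !mxE.
have const_mxN n r : - const_mx r = const_mx (- r) :> 'rV[R]_n.
  by apply/rowP => l; rewrite !mxE.
have sumb : \sum_l b 0 l = 0.
  by rewrite /b const_mxN sum_shift /c mulNr divfK ?subrr ?natr0.
have sumg : \sum_l g 0 l = 0.
  by rewrite /g const_mxN sum_shift /c' mulNr divfK ?subrr ?natr0.
pose M := dot xi (o_pt d1 k d s).
have ME : dot (triple_point a b g) (o_pt d1 k d s) = M.
  have sumc n : (0 < n)%N -> \sum_l (const_mx (s / n%:R) : 'rV[R]_n) 0 l = s.
    move=> n0; under eq_bigr do rewrite mxE.
    by rewrite sumr_const card_ord -[LHS]mulr_natr divfK ?natr0.
  by rewrite /M xiE; apply: (@dot_shift _ _ _ _ _ s); exact: sumc.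
have abgP p : N0 Q u v w p -> dot (triple_point a b g) p <= M - dot xi xi.
  move=> /[dup] /xiP; rewrite -/M => xip.
  case=> r [al [be [ga [[sa sb sg] [_ pE _]]]]].
  suff -> : dot (triple_point a b g) p = dot xi p by [].
  have sumn n (f : 'I_n -> nat) : (\sum_l f l = r)%N ->
      \sum_l (\row_l' (f l')%:R : 'rV[R]_n) 0 l = r%:R.
    by move=> <-; rewrite natr_sum; apply: eq_bigr => l _; rewrite mxE.
  by rewrite pE xiE; apply: (@dot_shift _ _ _ _ _ r%:R); exact: sumn.
(* The origin lies in [N0], so [M] is positive; as the other two sums vanish, [M] is s / d1 times
   the sum of [a], which must therefore be positive. *)
have M0 : dot xi xi <= M.
  by have := abgP _ N00; rewrite {1}/dot trmx0 mulmx0 mxE subr_ge0.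
have suma : 0 < \sum_l a 0 l.
  have := lt_le_trans xi0 M0; rewrite -ME dot_o_pt sumb sumg !mul0r !addr0.
  rewrite mulrC => H; have s'0 : 0 <= s / d1%:R by rewrite divr_ge0.
  by rewrite ltNge; apply/negP => a_le0; move: H; rewrite ltNge mulr_ge0_le0.
have [D1 [sD1 D1u trD1]] := diagonal_in_basis (a 0) ou.
have [D2 [sD2 D2v trD2]] := diagonal_in_basis (b 0) ov.
have [D3 [sD3 D3w trD3]] := diagonal_in_basis (g 0) ow.
exists u, v, w, D1, D2, D3; do 2!split=> //; split.
  by split=> i; eexists; [exact: D1u|exact: D2v|exact: D3w].
split; first by rewrite trD1 trD2 trD3.
rewrite /=; under eq_fun do rewrite (expmx_scale_eigen _ ou D1u)
  (expmx_scale_eigen _ ov D2v) (expmx_scale_eigen _ ow D3w).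
have tripleZ t : triple_point (t *: a) (t *: b) (t *: g) = t *: triple_point a b g.
  by rewrite /triple_point !scale_row_mx.
have weightE t : det_weight s (fun i => expR ((t *: a) 0 i) *: u i)
    (fun i => expR ((t *: b) 0 i) *: v i) (fun i => expR ((t *: g) 0 i) *: w i) =
    expR (t * M).
  rewrite (col_basis_mx u) (col_basis_mx v) (col_basis_mx w).
  by rewrite det_weight_expR ?tripleZ ?dotZl ?ME //; exact/orthonormal_basisP.
under eq_fun do rewrite weightE.
(* The ratio lies between 0 and e^(- |xi|^2 t) times the value of [calQ] at the fixed orthonormal
   bases. *)
apply: (@squeeze_cvgr _ _ _ _ (fun=> 0)
  (fun t => expR (- (dot xi xi * t)) * calQ Q u v w)); last 2 first.
- exact: cvg_cst.
- rewrite -[X in _ --> X](mul0r (calQ Q u v w)); apply: cvgM; last exact: cvg_cst.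
  apply: (cvg_comp _ _ _ (@cvgr_expR R)).
  exact: (gt0_cvgMry xi0 cvg_id).
near=> t.
have t0 : 0 <= t by near: t; exact: nbhs_pinfty_ge.
rewrite divr_ge0 ?expR_ge0 ?sqrtr_ge0 //= ler_pdivrMr ?expR_gt0 //.
rewrite mulrAC -expRD.
have -> : - (dot xi xi * t) + t * M = t * (M - dot xi xi) by ring.
apply: calQ_expR_le => // p Np.
by rewrite tripleZ dotZl ler_wpM2l // abgP.
Unshelve. all: by end_near. Qed.

End Dichotomy.

Theorem lemma1 (R : realType) (d1 k d : nat)
    (hd1 : (0 < d1)%N) (hk : (0 < k)%N) (hd : (0 < d)%N)
    (Q : triform R d1 k d) (hQ : trilinear Q) :
  (forall s : R, 0 <= s ->
     (NR Q (o_pt d1 k d s) <->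
      exists2 c : R, 0 < c &
        near_form Q (fun Q' =>
          forall u v w, is_basis u -> is_basis v -> is_basis w ->
            c * det_weight s u v w <= calQ Q' u v w)))
  /\
  (forall s : R, 0 <= s ->
     (~ NR Q (o_pt d1 k d s) <->
      exists (u : 'I_d1 -> 'cV[R]_d1) (v : 'I_k -> 'cV[R]_k)
             (w : 'I_d -> 'cV[R]_d)
             (D1 : 'M[R]_d1) (D2 : 'M[R]_k) (D3 : 'M[R]_d),
        [/\ orthonormal_basis u, orthonormal_basis v & orthonormal_basis w] /\
        [/\ symmetric_mx D1, symmetric_mx D2 & symmetric_mx D3] /\
        [/\ diagonalizes u D1, diagonalizes v D2 & diagonalizes w D3] /\
        [/\ 0 < \tr D1, \tr D2 = 0 & \tr D3 = 0] /\
        (let U (tau : R) := fun i => expmx (tau *: D1) *m u i in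
         let V (tau : R) := fun i => expmx (tau *: D2) *m v i in
         let W (tau : R) := fun i => expmx (tau *: D3) *m w i in
         calQ Q (U tau) (V tau) (W tau) / det_weight s (U tau) (V tau) (W tau)
           @[tau --> +oo] --> (0 : R)))).
Proof.
have decay s := @not_NR_decaying_bases R d1 k d hd1 hk hd Q hQ s.
have not_bdd s := @decaying_bases_not_bounded R d1 k d Q hQ s.
split=> s s0; split.
(* Membership gives the bound, decay excludes the bound, and failure of membership gives decay: this
   cycle yields all four implications. *)
- exact: NR_calQ.
- by move=> bdd; apply: contrapT => /(decay s s0) /not_bdd; apply.
- exact: decay.
by move=> /not_bdd unbdd /(NR_calQ hQ).
Qed.
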